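(* Suppose that the uncertainty set is a polytope of the form $\Xi=\{\xi\in\mathbb{R}^m:C\xi\le d\}$, where $C$ is a matrix and $d$ a vector of appropriate dimensions, and let $\varepsilon\ge0$. (i) If $\ell(\xi)=\inf_y\{\langle y,Q\xi\rangle:Wy\ge h\}$ is the optimal value of a parametric linear program with objective uncertainty, and if the feasible set $\{y:Wy\ge h\}$ is non-empty and compact, then the worst-case expectation $\sup_{\mathbb{Q}\in\mathbb{B}_\varepsilon(\widehat{\mathbb{P}}_N)}\mathbb{E}^{\mathbb{Q}}[\ell(\xi)]$ is given by $$\begin{array}{cll}\inf\limits_{\lambda,s_i,\gamma_i,y_i}&\lambda\varepsilon+\frac1N\sum\limits_{i=1}^Ns_i&\\ \text{s.t.}&\langle y_i,Q\widehat\xi_i\rangle+\langle\gamma_i,d-C\widehat\xi_i\rangle\le s_i&\forall i\le N\\ &Wy_i\ge h&\forall i\le N\\ &\|Q^\top y_i-C^\top\gamma_i\|_*\le\lambda&\forall i\le N\\ &\gamma_i\ge0&\forall i\le N.\end{array}$$ (ii) If $\ell(\xi)=\inf_y\{\langle q,y\rangle:Wy\ge H\xi+h\}$ is the optimal value of a parametric linear program with right-hand side uncertainty, and if the dual feasible set $\{\theta\ge0:W^\top\theta=q\}$ is non-empty and compact with vertices $v_k$, $k\le K$, then the worst-case expectation $\sup_{\mathbb{Q}\in\mathbb{B}_\varepsilon(\widehat{\mathbb{P}}_N)}\mathbb{E}^{\mathbb{Q}}[\ell(\xi)]$ is given by $$\begin{array}{cll}\inf\limits_{\lambda,s_i,\gamma_{ik}}&\lambda\varepsilon+\frac1N\sum\limits_{i=1}^Ns_i&\\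 \text{s.t.}&\langle v_k,h\rangle+\langle H^\top v_k,\widehat\xi_i\rangle+\langle\gamma_{ik},d-C\widehat\xi_i\rangle\le s_i&\forall i\le N,\ \forall k\le K\\ &\|C^\top\gamma_{ik}-H^\top v_k\|_*\le\lambda&\forall i\le N,\ \forall k\le K\\ &\gamma_{ik}\ge0&\forall i\le N,\ \forall k\le K.\end{array}$$
   Context: Notation: $\langle a,b\rangle=a^\top b$; $\|\cdot\|$ is an arbitrary norm on $\mathbb{R}^m$ with dual norm $\|z\|_*=\sup_{\|\xi\|\le1}\langle z,\xi\rangle$; vector inequalities are componentwise. $Q,W,H$ are real matrices and $h,q$ real vectors of appropriate dimensions. $\lambda$ and $s_i$ are real; $\gamma_i,\gamma_{ik},y_i$ are real vectors of matching dimension. Data and ball: $\widehat\xi_1,\dots,\widehat\xi_N\in\Xi$ are given points and $\widehat{\mathbb{P}}_N=\frac1N\sum_{i=1}^N\delta_{\widehat\xi_i}$. $\mathcal{M}(\Xi)$ is the set of probability distributions $\mathbb{Q}$ supported on $\Xi$ with $\mathbb{E}^{\mathbb{Q}}[\|\xi\|]<\infty$; $d_{\mathrm W}(\mathbb{Q}_1,\mathbb{Q}_2)=\inf_\Pi\int_{\Xi^2}\|\xi_1-\xi_2\|\,\Pi(d\xi_1,d\xi_2)$ over joint distributions $\Pi$ with marginals $\mathbb{Q}_1,\mathbb{Q}_2$; $\mathbb{B}_\varepsilon(\widehat{\mathbb{P}}_N)=\{\mathbb{Q}\in\mathcal{M}(\Xi):d_{\mathrm W}(\widehat{\mathbb{P}}_N,\mathbb{Q})\le\varepsilon\}$.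 *)

(* Defs.v *)
From HB Require Import structures.
From mathcomp Require Import all_boot all_order all_algebra.
From mathcomp Require Import all_classical all_reals all_analysis.
Set Implicit Arguments.
Unset Strict Implicit.
Unset Printing Implicit Defensive.
Import Order.TTheory GRing.Theory Num.Theory numFieldNormedType.Exports.
Local Open Scope classical_set_scope.
Local Open Scope ring_scope.

Definition dotv (R : realType) (n : nat) (a b : 'cV[R]_n) : R :=
  (a^T *m b) 0 0.

Definition lev (R : realType) (n : nat) (a b : 'cV[R]_n) : Prop :=
  forall i, a i 0 <= b i 0.

(* Nonnegativity and [nrm 0 = 0] follow from the three axioms. *)
Record vector_norm (R : realType) (m : nat) (nrm : 'cV[R]_m -> R) : Prop := {
  vnorm_triangle : forall x y, nrm (x + y) <= nrm x + nrm y ;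
  vnorm_homogeneous : forall a x, nrm (a *: x) = `|a| * nrm x ;
  vnorm_definite : forall x, nrm x = 0 -> x = 0 }.

Definition dual_norm (R : realType) (m : nat) (nrm : 'cV[R]_m -> R)
    (z : 'cV[R]_m) : \bar R :=
  ereal_sup [set (dotv z xi)%:E | xi in [set xi | nrm xi <= 1]].

(* The topology on ['cV[R]_m] is the usual one on R^m, so that this is R^m
   with its Borel sigma-algebra. *)
Definition borelRm (R : realType) (m : nat) :=
  g_sigma_algebraType (@open 'cV[R]_m).

HB.instance Definition _ (R : realType) (m : nat) :=
  Measurable.on (borelRm R m).

Definition polyhedron (R : realType) (p m : nat) (C : 'M[R]_(p, m))
    (d : 'cV[R]_p) : set 'cV[R]_m :=
  [set xi | lev (C *m xi) d].

(* The points of a polyhedron that are not proper convex combinations of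
   other points of it. *)
Definition vertices (R : realType) (n : nat) (A : set 'cV[R]_n) :
    set 'cV[R]_n :=
  [set x | A x /\ forall a b t, A a -> A b -> 0 < t < 1 ->
    x = t *: a + (1 - t) *: b -> a = x /\ b = x].

Section empirical.
Context (R : realType) (m N : nat) (hN : (0 < N)%N) (xi : 'I_N -> 'cV[R]_m).
Local Open Scope ereal_scope.

Definition empirical of (0 < N)%N : set (borelRm R m) -> \bar R :=
  fun A => (N%:R^-1)%:E * \sum_(i < N) \d_(xi i : borelRm R m) A.

Let mu := empirical hN.

Let mu0 : mu set0 = 0.
Proof. by rewrite /mu /empirical big1 ?mule0// => i _; rewrite measure0. Qed.

Let mu_ge0 A : 0 <= mu A.
Proof. by rewrite mule_ge0 ?lee_fin ?invr_ge0// sume_ge0. Qed.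

Let mu_sigma_additive : semi_sigma_additive mu.
Proof.
pose D (k : nat) : {measure set borelRm R m -> \bar R} :=
  if insub k is Some i then dirac (xi i : borelRm R m) else mzero.
have N0 : (0 <= (N%:R : R)^-1)%R by rewrite invr_ge0.
have -> : mu = mscale (NngNum N0) (msum D N).
  apply/funext => A; rewrite /mu /empirical /mscale /msum /=; congr (_ * _).
  by apply: eq_bigr => i _; rewrite /D valK.
exact: measure_semi_sigma_additive.
Qed.

HB.instance Definition _ := isMeasure.Build _ _ _ (empirical hN)
  mu0 mu_ge0 mu_sigma_additive.

Let mu1 : mu setT = 1.
Proof.
rewrite /mu /empirical (eq_bigr (fun=> 1)); last by move=> i _; rewrite diracT.
rewrite sumEFin sumr_const card_ord -EFinM mulVf// pnatr_eq0.
by rewrite -lt0n.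
Qed.

HB.instance Definition _ :=
  Measure_isProbability.Build _ _ _ (empirical hN) mu1.

End empirical.

Section ambiguity.
Context (R : realType) (m : nat) (Xi : set 'cV[R]_m) (nrm : 'cV[R]_m -> R).
Local Notation T := (borelRm R m).
Local Open Scope ereal_scope.

Definition finite_mean_distributions : set (probability T R) :=
  [set P : probability T R | P Xi = 1 /\ \int[P]_(xi in Xi) (nrm xi)%:E < +oo].

Definition couplings (P1 P2 : probability T R) :
    set (probability (T * T)%type R) :=
  [set Pi : probability (T * T)%type R |
            (forall A, measurable A -> pushforward Pi fst A = P1 A) /\
            (forall A, measurable A -> pushforward Pi snd A = P2 A)].

(* A coupling of two distributions supported on [Xi] is automatically
   supported on [Xi `*` Xi]. *)
Definition wasserstein (P1 P2 : probability T R) : \bar R :=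
  ereal_inf [set \int[Pi]_(z in Xi `*` Xi) (nrm ((z.1 : 'cV[R]_m) - z.2))%:E
            | Pi in couplings P1 P2].

Definition wasserstein_ball (P0 : probability T R) (eps : R) :
    set (probability T R) :=
  [set P : probability T R |
      finite_mean_distributions P /\ wasserstein P0 P <= eps%:E].

Definition worst_case_expectation (P0 : probability T R) (eps : R)
    (loss : 'cV[R]_m -> \bar R) : \bar R :=
  ereal_sup [set \int[P]_xi loss xi | P in wasserstein_ball P0 eps].

End ambiguity.

Section two_stage.
Context (R : realType) (m n l : nat).
Local Open Scope ereal_scope.

Definition loss_objective (Q : 'M[R]_(n, m)) (W : 'M[R]_(l, n)) (h : 'cV[R]_l)
    (xi : 'cV[R]_m) : \bar R :=
  ereal_inf [set (dotv y (Q *m xi))%:E |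
               y in [set y : 'cV[R]_n | lev h (W *m y)]].

Definition loss_rhs (q : 'cV[R]_n) (W : 'M[R]_(l, n)) (H : 'M[R]_(l, m))
    (h : 'cV[R]_l) (xi : 'cV[R]_m) : \bar R :=
  ereal_inf [set (dotv q y)%:E |
               y in [set y : 'cV[R]_n | lev (H *m xi + h) (W *m y)]].

Definition dual_feasible (q : 'cV[R]_n) (W : 'M[R]_(l, n)) : set 'cV[R]_l :=
  [set theta | lev 0 theta /\ W^T *m theta = q].

End two_stage.

(* Main.v *)
From HB Require Import structures.
Require Import Defs.
From mathcomp Require Import all_boot all_order all_algebra.
From mathcomp Require Import all_classical all_reals all_analysis.
From mathcomp Require Import measurable_realfun ring lra.
Import Order.TTheory GRing.Theory Num.Theory numFieldNormedType.Exports.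
Local Open Scope classical_set_scope.
Local Open Scope ring_scope.
Set Implicit Arguments.
Unset Strict Implicit.
Unset Printing Implicit Defensive.

(** Both losses are maxima over k of minima over convex sets [A k] of affine
functions: in (i) there is one piece, the minimum over the feasible set of the
recourse; in (ii) linear programming duality makes the loss the maximum of K
affine functions, one for each vertex of the dual feasible set. The two claims
are instances of one duality theorem, [maxmin_duality], for such losses.

Weak duality. A dual point (lambda, s, gamma, a) makes the loss smaller, on
the polyhedron, than every cone s_i + lambda |x - xihat_i|. The minimum of
these cones is lambda-Lipschitz, so along a coupling of almost optimal cost its
expectation grows by at most lambda eps from the empirical distribution to
another member of the ball ([lipschitz_expectation_le]), and it is at most s_i
at xihat_i.

Strong duality. Only discrete distributions are needed, which split the mass
1/N of xihat_i into fractions alpha_ik moved by w_ik / alpha_ik. In the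
variables (alpha, w) admissible plans form a compact convex set, and for fixed
multipliers (gamma, a) the payoff
  1/N sum_ik alpha_ik (<z_ik, xihat_i> + c_ik + <gamma_ik, d - C xihat_i>)
    + <z_ik - C^T gamma_ik, w_ik>
is linear in the plan and affine in the multipliers. Its largest value over
plans is exactly the best dual objective for these multipliers: the masses
concentrate on the largest constraint, and the transport budget on a single
displacement attaining the largest dual norm ([payoff_ge_dual]). Fan's minimax
theorem ([minimax]) exchanges the two optimisations and yields a single plan
that is good against all multipliers. After mixing in a little of the plan that
does not move anything, all alpha_ik are positive; arbitrarily large gamma then
force the atoms xihat_i + w_ik / alpha_ik into the polyhedron, and gamma = 0
bounds the expected loss from below ([positive_plan_expectation]). Compactness
sits on the side of the plans, which is why the exchange also covers eps = 0 and
polyhedra without interior points.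

Linear programming duality for (ii) comes from the same minimax theorem. A
non-empty compact dual feasible set provides a Slater point of the primal
constraints ([slater_point]); its cost caps the multipliers, which makes the
dual side compact ([lp_strong_duality]). *)

(** * Inner product and topology of column vectors *)

Section dot_product.
Context (R : realType).

Lemma dotvE n (a b : 'cV[R]_n) : dotv a b = \sum_i a i 0 * b i 0.
Proof. by rewrite /dotv mxE; apply: eq_bigr => i _; rewrite mxE. Qed.

Lemma dotvC n (a b : 'cV[R]_n) : dotv a b = dotv b a.
Proof. by rewrite !dotvE; apply: eq_bigr => i _; rewrite mulrC. Qed.

Lemma dotvDr n (a b c : 'cV[R]_n) : dotv a (b + c) = dotv a b + dotv a c.
Proof. by rewrite /dotv mulmxDr mxE. Qed.

Lemma dotvDl n (a b c : 'cV[R]_n) : dotv (a + b) c = dotv a c + dotv b c.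
Proof. by rewrite dotvC dotvDr !(dotvC c). Qed.

Lemma dotvZr n k (a b : 'cV[R]_n) : dotv a (k *: b) = k * dotv a b.
Proof. by rewrite /dotv -scalemxAr mxE. Qed.

Lemma dotvZl n k (a b : 'cV[R]_n) : dotv (k *: a) b = k * dotv a b.
Proof. by rewrite dotvC dotvZr dotvC. Qed.

Lemma dotvNr n (a b : 'cV[R]_n) : dotv a (- b) = - dotv a b.
Proof. by rewrite -scaleN1r dotvZr mulN1r. Qed.

Lemma dotvNl n (a b : 'cV[R]_n) : dotv (- a) b = - dotv a b.
Proof. by rewrite dotvC dotvNr dotvC. Qed.

Lemma dotvBr n (a b c : 'cV[R]_n) : dotv a (b - c) = dotv a b - dotv a c.
Proof. by rewrite dotvDr dotvNr. Qed.

Lemma dotvBl n (a b c : 'cV[R]_n) : dotv (a - b) c = dotv a c - dotv b c.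
Proof. by rewrite dotvDl dotvNl. Qed.

Lemma dot0v n (a : 'cV[R]_n) : dotv 0 a = 0.
Proof. by rewrite -(scale0r 0) dotvZl mul0r. Qed.

Lemma dotv0 n (a : 'cV[R]_n) : dotv a 0 = 0.
Proof. by rewrite dotvC dot0v. Qed.

Lemma dotv_trmx p n (A : 'M[R]_(p, n)) y x : dotv (A^T *m y) x = dotv y (A *m x).
Proof. by rewrite /dotv trmx_mul trmxK mulmxA. Qed.

Lemma mulmx_row_dotv p n (A : 'M[R]_(p, n)) x i :
  (A *m x) i 0 = dotv (row i A)^T x.
Proof. by rewrite dotvE mxE; apply: eq_bigr => j _; rewrite !mxE. Qed.

Lemma dotv_ge0 n (a b : 'cV[R]_n) : lev 0 a -> lev 0 b -> 0 <= dotv a b.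
Proof.
move=> a0 b0; rewrite dotvE sumr_ge0// => i _.
by have := a0 i; have := b0 i; rewrite !mxE => ? ?; exact: mulr_ge0.
Qed.

Lemma dotv_delta n (a : 'cV[R]_n) i : dotv (delta_mx i 0) a = a i 0.
Proof.
rewrite dotvE (bigD1 i)//= big1 ?addr0 => [|j ji].
  by rewrite mxE !eqxx mul1r.
by rewrite mxE (negbTE ji) mul0r.
Qed.

Lemma lev_subr n (a b : 'cV[R]_n) : lev a b <-> lev 0 (b - a).
Proof. by split=> + i => /(_ i); rewrite !mxE subr_ge0. Qed.

Lemma continuous_sum (T : topologicalType) (I : finType) (f : I -> T -> R) :
  (forall i, continuous (f i)) -> continuous (fun x => \sum_i f i x).
Proof.
by move=> fc; apply: continuous_big => //; exact: add_continuous.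
Qed.

Lemma dotv_continuous n (a : 'cV[R]_n) : continuous (dotv a).
Proof.
rewrite (_ : dotv a = fun x => \sum_i a i 0 * x i 0); last first.
  by apply/funext => x; rewrite dotvE.
apply: continuous_sum => i x.
apply: (@continuousM _ _ (fun=> a i 0) (fun y : 'cV_n => y i 0)).
  exact: cst_continuous.
exact: coord_continuous.
Qed.

Lemma dotv_le_mx n (z x : 'cV[R]_n) : dotv z x <= (\sum_i `|z i 0|) * `|x|.
Proof.
rewrite dotvE mulr_suml ler_sum// => i _.
rewrite (le_trans (ler_norm _))// normrM ler_wpM2l//.
rewrite [leRHS]/Num.Def.normr/= mx_normrE.
by apply/bigmax_geP; right => /=; exists (i, 0).
Qed.

(** The Heine-Borel theorem for column vectors, transported from row vectors
    along transposition. *)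
Lemma cV_bounded_closed_compact n (A : set 'cV[R]_n) M :
  (forall x, A x -> `|x| <= M) -> closed A -> compact A.
Proof.
move=> AM cA.
have trc a b : continuous (@trmx R a b).
  move=> x S [P xP PS]; exists (fun i j => P j i) => [i j|y yP].
    by have := xP j i; rewrite mxE.
  by apply: PS => i j /=; rewrite mxE; exact: yP.
have -> : A = trmx @` [set x : 'rV[R]_n | A x^T].
  apply/seteqP; split=> [x Ax|x [y Ay <-]//].
  by exists x^T => //=; rewrite trmxK.
apply: continuous_compact.
  by apply: continuous_subspaceT => x; exact: trc.
apply: bounded_closed_compact.
  exists M; split; first exact: num_real.
  move=> x Mx y /= /AM yM; apply: le_trans (ltW Mx).
  rewrite (le_trans _ yM)// [leLHS]/Num.Def.normr [leRHS]/Num.Def.normr/=.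
  rewrite !mx_normrE; apply/bigmax_leP; split.
    by apply/bigmax_geP; left.
  move=> -[i j] _ /=; apply/bigmax_geP; right; exists (j, i) => //=.
  by rewrite mxE.
apply: (preimage_closed _ cA) => x _; exact: trc.
Qed.

End dot_product.

(** * Arbitrary norms and their duals *)

Section norm_theory.
Context (R : realType) (m : nat) (nrm : 'cV[R]_m -> R).
Hypothesis hnrm : vector_norm nrm.

Lemma vnorm0 : nrm 0 = 0.
Proof. by rewrite -(scale0r 0) (vnorm_homogeneous hnrm) normr0 mul0r. Qed.

Lemma vnormN x : nrm (- x) = nrm x.
Proof. by rewrite -scaleN1r (vnorm_homogeneous hnrm) normrN1 mul1r. Qed.

Lemma vnormBC x y : nrm (x - y) = nrm (y - x).
Proof. by rewrite -vnormN opprB. Qed.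

Lemma vnorm_ge0 x : 0 <= nrm x.
Proof.
have := vnorm_triangle hnrm x (- x).
by rewrite subrr vnorm0 vnormN -mulr2n pmulrn_lge0.
Qed.

Lemma vnorm_distD x y z : nrm (x - z) <= nrm (x - y) + nrm (y - z).
Proof. by rewrite -[x - z](subrKA y) (vnorm_triangle hnrm). Qed.

Lemma vnorm_sum (I : Type) (s : seq I) (f : I -> 'cV[R]_m) :
  nrm (\sum_(i <- s) f i) <= \sum_(i <- s) nrm (f i).
Proof.
elim: s => [|i s IH]; first by rewrite !big_nil vnorm0.
by rewrite !big_cons (le_trans (vnorm_triangle hnrm _ _))// lerD2l.
Qed.

Lemma vnorm_le_mx : exists2 c, 0 <= c & forall x, nrm x <= c * `|x|.
Proof.
exists (\sum_i nrm (delta_mx i 0)).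
  by rewrite sumr_ge0// => i _; exact: vnorm_ge0.
move=> x; rewrite {1}(matrix_sum_delta x) (le_trans (vnorm_sum _ _))//.
rewrite mulr_suml ler_sum// => i _; rewrite big_ord1.
rewrite (vnorm_homogeneous hnrm) mulrC ler_wpM2l ?vnorm_ge0//.
rewrite [leRHS]/Num.Def.normr/= mx_normrE.
by apply/bigmax_geP; right => /=; exists (i, 0).
Qed.

Lemma vnorm_lip x y : `|nrm x - nrm y| <= nrm (x - y).
Proof.
have := vnorm_distD x y 0; have := vnorm_distD y x 0.
rewrite !subr0 (vnormBC y x) ler_norml => h1 h2.
by apply/andP; split; lra.
Qed.

(** The sup norm, which defines the topology, dominates every norm up to a
    constant. *)
Lemma lipschitz_continuous (f : 'cV[R]_m -> R) L :
  (forall x y, f x - f y <= L * nrm (x - y)) -> continuous f.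
Proof.
have [c c0 cP] := vnorm_le_mx => fL x.
move=> A /nbhs_ballP[e /= e0 eA].
pose k := `|L| * c + 1.
have k0 : 0 < k by rewrite ltr_wpDl// mulr_ge0.
have {}fL a b : f a - f b <= k * `|a - b|.
  rewrite (le_trans (fL a b))// (le_trans (ler_norm _))// normrM.
  rewrite (ger0_norm (vnorm_ge0 _)) mulrDl mul1r.
  rewrite (@le_trans _ _ (`|L| * c * `|a - b|)) ?lerDl//.
  by rewrite -mulrA ler_wpM2l.
apply/nbhs_ballP; exists (e / k) => /=; first exact: divr_gt0.
move=> y; rewrite mx_norm_ball /ball_/= ltr_pdivlMr// mulrC => xy.
apply: eA; apply: le_lt_trans xy.
by rewrite ler_norml lerNl opprB {1}distrC !fL.
Qed.

Lemma vnorm_continuous : continuous nrm.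
Proof.
apply: (@lipschitz_continuous _ 1) => x y; rewrite mul1r.
exact: le_trans (ler_norm _) (vnorm_lip x y).
Qed.

(** Compactness of the sup-norm sphere bounds an arbitrary norm from below on
    it; this is the nontrivial half of the equivalence of norms. *)
Lemma mx_le_vnorm : exists2 c, 0 <= c & forall x, `|x| <= c * nrm x.
Proof.
pose S := [set x : 'cV[R]_m | `|x| = 1].
have cS : compact S.
  apply: (@cV_bounded_closed_compact _ _ _ 1) => [x ->//|].
  rewrite (_ : S = (fun x : 'cV[R]_m => `|x|) @^-1` [set 1])//.
  apply: preimage_closed => [x _|]; first exact: norm_continuous.
  exact: closed_eq.
have xS (x : 'cV[R]_m) : x != 0 -> S (`|x|^-1 *: x).
  by move=> x0; rewrite /S/= normrZ normfV normr_id mulVf ?normr_eq0.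
have [S0|/set0P S0] := eqVneq S set0.
  exists 0 => // x; rewrite mul0r normr_le0; apply/negP => /negP /xS.
  by rewrite S0.
have [a aS amin] : exists2 a, a \in S & forall t, t \in S -> nrm a <= nrm t.
  apply: compact_EVT_min => //; apply: continuous_subspaceT.
  exact: vnorm_continuous.
have a0 : 0 < nrm a.
  rewrite lt_neqAle vnorm_ge0 andbT; apply/eqP => /esym/(vnorm_definite hnrm).
  move=> a0; move: aS; rewrite inE /S/= a0 normr0 => /eqP.
  by rewrite eq_sym oner_eq0.
exists (nrm a)^-1; first by rewrite invr_ge0 ltW.
move=> x; have [->|x0] := eqVneq x 0; first by rewrite vnorm0 normr0 mulr0.
rewrite mulrC ler_pdivlMr// mulrC -ler_pdivlMr ?normr_gt0// mulrC.
rewrite -[X in X * _]ger0_norm ?invr_ge0// -(vnorm_homogeneous hnrm) amin//.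
by rewrite inE; exact: xS.
Qed.

(** The sign of [lambda] has to be recorded separately: in dimension zero the
    inequalities on the right hold for every [lambda]. *)
Lemma dual_norm_leP z lambda :
  (dual_norm nrm z <= lambda%:E)%E <->
  0 <= lambda /\ forall x, dotv z x <= lambda * nrm x.
Proof.
split=> [zl|[l0 zl]]; last first.
  apply: ge_ereal_sup => _ [x /= x1 <-]; rewrite lee_fin (le_trans (zl x))//.
  by rewrite ler_piMr.
have {}zl x : nrm x <= 1 -> dotv z x <= lambda.
  move=> x1; rewrite -lee_fin (le_trans _ zl)//.
  by apply: ereal_sup_ubound; exists x.
split=> [|x]; first by rewrite -(dotv0 z) zl ?vnorm0.
have [/(vnorm_definite hnrm)->|x0] := eqVneq (nrm x) 0.
  by rewrite dotv0 vnorm0 mulr0.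
have {}x0 : 0 < nrm x by rewrite lt_neqAle eq_sym x0 vnorm_ge0.
rewrite -ler_pdivrMr// mulrC -dotvZr zl// (vnorm_homogeneous hnrm).
by rewrite ger0_norm ?invr_ge0 ?vnorm_ge0// mulVf// gt_eqF.
Qed.

Lemma vnorm_ball_compact r : compact [set x | nrm x <= r].
Proof.
have [c c0 cP] := mx_le_vnorm.
apply: (@cV_bounded_closed_compact _ _ _ (c * r)) => [x /= xr|].
  by rewrite (le_trans (cP x))// ler_wpM2l.
rewrite (_ : [set x | _] = nrm @^-1` [set t | t <= r])//.
by apply: preimage_closed => [x _|]; [exact: vnorm_continuous|exact: closed_le].
Qed.

Lemma dual_norm_attained z : exists2 x, nrm x <= 1 &
  0 <= dotv z x /\ (dual_norm nrm z <= (dotv z x)%:E)%E.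
Proof.
have [x xB xmax] : exists2 x, x \in [set x | nrm x <= 1] &
    forall y, y \in [set x | nrm x <= 1] -> dotv z y <= dotv z x.
  apply: compact_EVT_max; last first.
  - by apply: continuous_subspaceT; exact: dotv_continuous.
  - exact: vnorm_ball_compact.
  - by exists 0; rewrite /= vnorm0.
rewrite inE in xB; exists x => //; split.
  by rewrite -[leLHS](dotv0 z) xmax// inE/= vnorm0.
by apply: ge_ereal_sup => _ [y /= y1 <-]; rewrite lee_fin xmax// inE.
Qed.

End norm_theory.

(** * Borel measurability *)

Section borel.
Context (R : realType) (m : nat).
Implicit Types f : borelRm R m -> R.

Lemma borelRm_open_measurable (A : set 'cV[R]_m) :
  open A -> measurable (A : set (borelRm R m)).
Proof. by move=> oA; exact: sub_sigma_algebra. Qed.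

Lemma borelRm_closed_measurable (A : set 'cV[R]_m) :
  closed A -> measurable (A : set (borelRm R m)).
Proof.
move=> /closed_openC/borelRm_open_measurable/measurableC.
by rewrite setCK.
Qed.

Lemma borelRm_continuous_measurable (f : 'cV[R]_m -> R) :
  continuous f -> measurable_fun [set: borelRm R m] (f : borelRm R m -> R).
Proof.
move=> /continuousP cf; apply: (measurability _ (RGenOpens.measurableE R)).
move=> _ [_ [a [b ->] <-]]; rewrite setTI; apply: borelRm_open_measurable.
exact/cf/interval_open.
Qed.

Lemma polyhedron_closed p (C : 'M[R]_(p, m)) d : closed (polyhedron C d).
Proof.
have -> : polyhedron C d =
    \bigcap_(i in [set: 'I_p]) [set x | (C *m x) i 0 <= d i 0].
  by apply/seteqP; split=> x /= h i; [move=> _|]; exact: h.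
apply: closed_bigI => i _.
rewrite (_ : [set x | _] = dotv (row i C)^T @^-1` [set t | t <= d i 0]).
  by apply: preimage_closed => [x _|]; [exact: dotv_continuous|exact: closed_le].
by apply/seteqP; split=> x /=; rewrite mulmx_row_dotv.
Qed.

Lemma vnorm_rat_between (nrm : 'cV[R]_m -> R) (x y : 'cV[R]_m) r :
  vector_norm nrm -> nrm (x - y) < r ->
  exists2 q : 'cV[rat]_m, True &
    nrm (x - map_mx ratr q) + nrm (map_mx ratr q - y) < r.
Proof.
move=> hnrm xyr.
(* The detour through q costs at most twice its distance to x. *)
pose e := (r - nrm (x - y)) / 2.
have e0 : 0 < e by rewrite divr_gt0// subr_gt0.
have [c c0 cP] := vnorm_le_mx hnrm.
have c1 : 0 < c + 1 by rewrite ltr_wpDl.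
have [q qP] : exists q : 'cV[rat]_m, `|x - map_mx ratr q| < e / (c + 1).
  have h i : exists q : rat, `|x i 0 - ratr q| < e / (c + 1).
    have /rat_in_itvoo[q] : x i 0 - e / (c + 1) < x i 0 + e / (c + 1).
      by rewrite ltrBlDr -addrA ltrDl addr_gt0// divr_gt0.
    rewrite in_itv/= => /andP[q1 q2]; exists q.
    by rewrite ltr_norml; apply/andP; split; lra.
  exists (\col_i sval (cid (h i))).
  rewrite /Num.Def.normr/= mx_normrE bigmax_lt//=; first exact: divr_gt0.
  move=> -[i j] _; rewrite !mxE/= (ord1 j).
  exact: svalP (cid (h i)).
exists q => //=; set v := map_mx _ _ in qP *.
have xq : nrm (x - v) < e.
  apply: (le_lt_trans (cP _)).
  have : c * `|x - v| <= (c + 1) * `|x - v| by rewrite ler_wpM2r// lerDl.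
  by move/le_lt_trans; apply; rewrite mulrC -ltr_pdivlMr.
have := vnorm_distD hnrm v x y; rewrite (vnormBC hnrm v x).
by have : e * 2 = r - nrm (x - y) by [rewrite /e divfK]; lra.
Qed.

(** The distance to a second point is recovered from the distances to a
    countable dense set of intermediate points, so it is measurable for the
    product of the two Borel sigma-algebras. *)
Lemma vnorm_sub_measurable (nrm : 'cV[R]_m -> R) : vector_norm nrm ->
  measurable_fun [set: borelRm R m * borelRm R m]
    (fun z => nrm ((z.1 : 'cV[R]_m) - z.2)).
Proof.
move=> hnrm; apply: (measurability _ (RGenInftyO.measurableE R)).
move=> _ [_ [r ->] <-]; rewrite setTI.
pose rmx (q : 'cV[rat]_m) : 'cV[R]_m := map_mx ratr q.
have -> : (fun z : borelRm R m * borelRm R m => nrm ((z.1 : 'cV[R]_m) - z.2))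
    @^-1` `]-oo, r[ =
    \bigcup_(q : 'cV[rat]_m) [set z : borelRm R m * borelRm R m |
      nrm ((z.1 : 'cV[R]_m) - rmx q) + nrm (rmx q - z.2) < r].
  apply/seteqP; split=> -[x y] /=; rewrite in_itv/=; last first.
    move=> [q _ /=]; apply: le_lt_trans; exact: vnorm_distD.
  exact: vnorm_rat_between.
apply: countable_bigcupT_measurable => [|q]; first exact: countableP.
pose g (z : borelRm R m * borelRm R m) :=
  nrm ((z.1 : 'cV[R]_m) - rmx q) + nrm (rmx q - z.2).
have mg : measurable_fun setT g.
  have cn (b : 'cV[R]_m) : continuous (fun x : 'cV[R]_m => nrm (x - b)).
    apply: (@lipschitz_continuous _ _ _ hnrm _ 1) => x y.
    by rewrite mul1r lerBlDr vnorm_distD.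
  apply: measurable_funD.
    exact: (measurableT_comp (borelRm_continuous_measurable (cn (rmx q)))
      measurable_fst).
  rewrite (_ : (fun x => _) = fun z : borelRm R m * borelRm R m =>
      nrm ((z.2 : 'cV[R]_m) - rmx q)); last first.
    by apply/funext => z; rewrite (vnormBC hnrm).
  exact: (measurableT_comp (borelRm_continuous_measurable (cn (rmx q)))
    measurable_snd).
rewrite (_ : [set z | _] = g @^-1` `]-oo, r[).
  by rewrite -[X in measurable X]setTI; exact: mg.
by apply/seteqP; split=> z /=; rewrite in_itv.
Qed.

End borel.

(** * Finitely supported distributions *)

Section discrete.
Context d (T : measurableType d) (R : realType) (J : finType) (w : J -> R)
  (w_ge0 : forall j, 0 <= w j) (w_sum : \sum_j w j = 1) (x : J -> T).
Local Open Scope ereal_scope.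

(** Finite sums of measures are indexed by initial segments of the natural
    numbers, hence the padding by the zero measure. *)
Let atom (k : nat) : {measure set T -> \bar R} :=
  if insub k : option 'I_#|J| is Some i
  then mscale (NngNum (w_ge0 (enum_val i))) (dirac (x (enum_val i)))
  else mzero.

(** The proof that the weights sum to one is an argument of the measure so that
    its structure of probability can be inferred. *)
Definition discrete of (\sum_j w j = 1)%R := msum atom #|J|.

HB.instance Definition _ := Measure.on (discrete w_sum).

Lemma discreteE A : discrete w_sum A = \sum_j (w j)%:E * \d_(x j) A.
Proof.
rewrite [RHS]big_enum_val /discrete /msum /=; apply: eq_bigr => i _.
by rewrite /atom valK.
Qed.

Let discrete1 : discrete w_sum setT = 1.
Proof.
rewrite discreteE -[RHS]/(1%R%:E) -w_sum -sumEFin; apply: eq_bigr => j _.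
by rewrite diracT mule1.
Qed.

HB.instance Definition _ :=
  Measure_isProbability.Build _ _ _ (discrete w_sum) discrete1.

Lemma ge0_integral_discrete D (f : T -> \bar R) :
  measurable D -> measurable_fun D f -> (forall y, D y -> 0 <= f y) ->
  \int[discrete w_sum]_(y in D) f y = \sum_j (w j)%:E * (\d_(x j) D * f (x j)).
Proof.
move=> mD mf f0; rewrite ge0_integral_measure_sum// [RHS]big_enum_val.
apply: eq_bigr => i _; rewrite /atom valK ge0_integral_mscale//.
by rewrite integral_dirac.
Qed.

Lemma integral_discrete (f : T -> R) : measurable_fun setT f ->
  \int[discrete w_sum]_y (f y)%:E = (\sum_j w j * f (x j))%:E.
Proof.
move=> mf; have mEf : measurable_fun setT (EFin \o f) by exact/measurable_EFinP.
rewrite integralE ge0_integral_discrete//; last exact: measurable_funepos.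
rewrite ge0_integral_discrete//; last exact: measurable_funeneg.
have E (g : T -> \bar R) (g' : T -> R) : (forall y, g y = (g' y)%:E) ->
    \sum_j (w j)%:E * (\d_(x j) [set: T] * g (x j)) = (\sum_j w j * g' (x j))%:E.
  move=> gE; rewrite -sumEFin; apply: eq_bigr => j _.
  by rewrite diracT mul1e gE.
rewrite (E _ (fun y => Num.max (f y) 0%R)); last first.
  by move=> y; rewrite funeposE -EFin_max.
rewrite (E _ (fun y => Num.max (- f y)%R 0%R)); last first.
  by move=> y; rewrite funenegE -EFin_max.
rewrite -EFinB -sumrB; congr EFin; apply: eq_bigr => j _.
rewrite -mulrBr; congr (_ * _)%R.
by case: (leP (f (x j)) 0%R); case: (leP (- f (x j))%R 0%R); lra.
Qed.

End discrete.

(** * The Wasserstein ball *)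

Section marginal.
Context d1 d2 (X : measurableType d1) (Y : measurableType d2) (R : realType).
Context (phi : X -> Y) (mphi : measurable_fun setT phi).
Context (Pi : {measure set X -> \bar R}) (P : {measure set Y -> \bar R}).
Hypothesis PiP : forall A, measurable A -> pushforward Pi phi A = P A.
Local Open Scope ereal_scope.

Lemma marginal_integrable (f : Y -> \bar R) :
  P.-integrable setT f -> Pi.-integrable setT (f \o phi).
Proof.
move=> /integrableP[mf foo]; apply/integrableP; split.
  exact: measurableT_comp.
have mabs : measurable_fun setT (abse \o f) by exact: measurableT_comp.
rewrite -(@ge0_integral_pushforward _ _ _ _ _ _ mphi Pi setT (abse \o f))//.
  by rewrite (eq_measure_integral P)// => A mA _; exact: PiP.
by move=> y _; exact: abse_ge0.
Qed.

Lemma marginal_integral (f : Y -> \bar R) :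
  P.-integrable setT f -> \int[P]_y f y = \int[Pi]_x f (phi x).
Proof.
move=> fi; have mf : measurable_fun setT f by exact: (measurable_int P).
transitivity (\int[pushforward Pi phi]_y f y).
  by apply: eq_measure_integral => A mA _; rewrite -PiP.
rewrite (integral_pushforward mphi mf)//; exact: marginal_integrable.
Qed.

End marginal.

Section wasserstein_theory.
Context (R : realType) (m : nat) (nrm : 'cV[R]_m -> R) (hnrm : vector_norm nrm).
Context (Xi : set 'cV[R]_m) (cXi : closed Xi).
Context (N : nat) (hN : (0 < N)%N) (xihat : 'I_N -> 'cV[R]_m).
Local Notation T := (borelRm R m).
Local Notation P0 := (empirical xihat hN).

Let unif_ge0 (i : 'I_N) : 0 <= (N%:R^-1 : R).
Proof. by rewrite invr_ge0. Qed.

Let unif_sum : \sum_(i < N) (N%:R^-1 : R) = 1.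
Proof.
by rewrite sumr_const card_ord -[LHS]mulr_natr mulVf// pnatr_eq0 -lt0n.
Qed.

Let empirical_discrete :
  P0 = discrete unif_ge0 (xihat : 'I_N -> T) unif_sum :> (set T -> \bar R).
Proof.
apply/funext => A; rewrite discreteE /empirical ge0_sume_distrr//.
Qed.

Lemma integral_empirical (f : 'cV[R]_m -> R) : continuous f ->
  (\int[P0]_x (f x)%:E = (N%:R^-1 * \sum_(i < N) f (xihat i))%:E)%E.
Proof.
move=> cf; rewrite empirical_discrete integral_discrete.
  by rewrite mulr_sumr.
exact: borelRm_continuous_measurable.
Qed.

Section discrete_ball.
Context (J : finType) (w : J -> R) (w_ge0 : forall j, 0 <= w j)
  (w_sum : \sum_j w j = 1) (pr : J -> 'I_N) (x : J -> 'cV[R]_m).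
Hypothesis w_pr : forall i, \sum_(j | pr j == i) w j = N%:R^-1.

(** Moving, for each data point, its mass 1/N along the weights [w] is a
    coupling with the empirical distribution; its cost bounds the Wasserstein
    distance. *)
Lemma discrete_in_ball eps :
  (forall j, Xi (x j)) -> \sum_j w j * nrm (xihat (pr j) - x j) <= eps ->
  wasserstein_ball Xi nrm P0 eps (discrete w_ge0 (x : J -> T) w_sum).
Proof.
move=> Xix cost.
have mXi : measurable (Xi : set T) by exact: borelRm_closed_measurable.
have mnrm : measurable_fun [set: T] (nrm : T -> R).
  by apply: borelRm_continuous_measurable; exact: vnorm_continuous.
split; first split.
- rewrite /= discreteE; transitivity ((\sum_j w j)%:E); last by rewrite w_sum.
  rewrite -sumEFin; apply: eq_bigr => j _.
  by rewrite diracE mem_set ?mule1.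
- rewrite ge0_integral_discrete//; last 2 first.
    by apply/measurable_EFinP; exact: measurable_funTS.
    by move=> y _; rewrite lee_fin vnorm_ge0.
  rewrite (eq_bigr (fun j => (w j * nrm (x j))%:E)) ?sumEFin ?ltry// => j _.
  by rewrite diracE mem_set ?mul1e.
pose z j : T * T := (xihat (pr j), x j).
apply: ereal_inf_le; exists (\int[discrete w_ge0 z w_sum]_(z in Xi `*` Xi)
  (nrm ((z.1 : 'cV[R]_m) - z.2))%:E)%E.
  exists (discrete w_ge0 z w_sum) => //; split=> A mA.
    rewrite /pushforward/= discreteE /empirical ge0_sume_distrr//.
    rewrite (partition_big pr xpredT)//=; apply: eq_bigr => i _.
    rewrite (eq_bigr (fun j => (w j * \1_A (xihat i))%:E)); last first.
      by move=> j /eqP <-; rewrite /dirac/= !indicE.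
    by rewrite sumEFin -mulr_suml w_pr.
  by rewrite /pushforward [LHS]discreteE [RHS]discreteE.
rewrite ge0_integral_discrete; last 3 first.
- exact: measurableX.
- by apply/measurable_EFinP/measurable_funTS; exact: vnorm_sub_measurable.
- by move=> y _; rewrite lee_fin vnorm_ge0.
apply: (@le_trans _ _ (\sum_j (w j * nrm (xihat (pr j) - x j))%:E)%E).
  apply: lee_sum => j _; rewrite EFinM lee_wpmul2l ?lee_fin//=.
  rewrite /dirac indicE; case: (_ \in _); rewrite ?mul1r// mul0r.
  exact: vnorm_ge0.
by rewrite sumEFin lee_fin.
Qed.

Lemma worst_case_expectation_ge eps (f : 'cV[R]_m -> R) : continuous f ->
  (forall j, Xi (x j)) -> \sum_j w j * nrm (xihat (pr j) - x j) <= eps ->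
  ((\sum_j w j * f (x j))%:E <=
   worst_case_expectation Xi nrm P0 eps (EFin \o f))%E.
Proof.
move=> cf Xix cost; apply: ereal_sup_ubound.
exists (discrete w_ge0 (x : J -> T) w_sum); first exact: discrete_in_ball.
by rewrite integral_discrete//; exact: borelRm_continuous_measurable.
Qed.

End discrete_ball.


Hypothesis hxihat : forall i, Xi (xihat i).

Let mXi : measurable (Xi : set T).
Proof. exact: borelRm_closed_measurable. Qed.

Let empirical_Xi : P0 Xi = 1%E.
Proof.
rewrite empirical_discrete discreteE.
transitivity ((\sum_(i < N) (N%:R^-1 : R))%:E); last by rewrite unif_sum.
rewrite -sumEFin; apply: eq_bigr => i _.
by rewrite diracE mem_set ?mule1.
Qed.

Let complement_null (P : probability T R) : P Xi = 1%E -> P (~` Xi) = 0%E.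
Proof. by move=> PXi; rewrite probability_setC// PXi subee. Qed.

Lemma lipschitz_integrable (P : probability T R) (S : 'cV[R]_m -> R) L :
  finite_mean_distributions Xi nrm P ->
  (forall x y, S x - S y <= L * nrm (x - y)) ->
  P.-integrable setT (EFin \o (S : T -> R)).
Proof.
move=> [PXi Pfin] SL.
have cS := lipschitz_continuous hnrm SL.
have nrmi : P.-integrable setT (EFin \o (nrm : T -> R)).
  have mnrm : measurable_fun [set: T] (EFin \o (nrm : T -> R)).
    apply/measurable_EFinP.
    exact: (borelRm_continuous_measurable (vnorm_continuous hnrm)).
  apply/integrableP; split => //.
  rewrite (eq_integral (EFin \o (nrm : T -> R))); last first.
    by move=> x _; rewrite /= ger0_norm// vnorm_ge0.
  rewrite (ge0_negligible_integral (measurableC mXi) measurableT mnrm)//.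
  - by rewrite setTD setCK.
  - by move=> x _; rewrite lee_fin vnorm_ge0.
  - exact: complement_null.
pose g (x : T) : R := `|S 0| + `|L| * nrm x.
have gi : P.-integrable setT (EFin \o g).
  rewrite (_ : EFin \o g = ((EFin \o cst `|S 0|%R) \+
      (fun x => `|L|%R%:E * (EFin \o (nrm : T -> R)) x))%E)//.
  apply: integrableD => //; last exact: integrableZl.
  exact: finite_measure_integrable_cst.
apply: (le_integrable measurableT _ _ gi).
  by apply/measurable_EFinP; exact: borelRm_continuous_measurable.
move=> x _; rewrite lee_fin [leRHS]ger0_norm; last first.
  by rewrite addr_ge0// mulr_ge0// vnorm_ge0.
have Lx : L * nrm x <= `|L| * nrm x.
  by rewrite ler_wpM2r ?vnorm_ge0// ler_norm.
have := SL x 0; have := SL 0 x; rewrite subr0 sub0r vnormN//.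
have := ler_norm (S 0); have := ler_norm (- S 0); rewrite normrN.
move=> ? ? ? ?.
by rewrite ler_norml; apply/andP; split; rewrite /g; lra.
Qed.

(** The easy half of Kantorovich duality: transporting the integral of a
    Lipschitz function along a coupling costs at most the Lipschitz constant
    times the transport cost. *)
Lemma lipschitz_expectation_le (P : probability T R) eps (S : 'cV[R]_m -> R) L :
  0 <= L -> wasserstein_ball Xi nrm P0 eps P ->
  (forall x y, S x - S y <= L * nrm (x - y)) ->
  (\int[P]_x (S x)%:E <= (L * eps + N%:R^-1 * \sum_(i < N) S (xihat i))%:E)%E.
Proof.
move=> L0 [Pfm W] SL.
have cS := lipschitz_continuous hnrm SL.
have mS : measurable_fun [set: T] (S : T -> R).
  exact: borelRm_continuous_measurable.
have Si : P.-integrable setT (EFin \o (S : T -> R)) by exact: lipschitz_integrable SL.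
have S0i : (P0 : probability T R).-integrable setT (EFin \o (S : T -> R)).
  apply/integrableP; split; first exact/measurable_EFinP.
  rewrite (eq_integral (fun x : T => `|S x|%:E))// integral_empirical ?ltry//.
  by move=> x; exact: (cvg_norm (cS x)).
apply/lee_addgt0Pr => e e0.
have L1 : 0 < L + 1 by rewrite ltr_wpDl.
(* Dividing by [L + 1] rather than [L] allows [L] to vanish. *)
have : (wasserstein Xi nrm P0 P < (eps + e / (L + 1))%:E)%E.
  by rewrite (le_lt_trans W)// lte_fin ltrDl divr_gt0.
move=> /ereal_inf_lt[_ [Pi [Pi1 Pi2] <-]] cost.
pose D (z : T * T) : R := nrm ((z.1 : 'cV[R]_m) - z.2).
have mD : measurable_fun [set: T * T] (EFin \o D).
  by apply/measurable_EFinP; exact: vnorm_sub_measurable.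
have D0 (z : T * T) : (0 <= (D z)%:E)%E by rewrite lee_fin vnorm_ge0.
have mXX : measurable (Xi `*` Xi : set (T * T)) by exact: measurableX.
have PiXX : Pi (~` (Xi `*` Xi)) = 0%E.
  apply/eqP; rewrite eq_le measure_ge0 andbT.
  pose A1 : set (T * T) := fst @^-1` (~` Xi).
  pose A2 : set (T * T) := snd @^-1` (~` Xi).
  have m1 : measurable A1.
    rewrite -[X in measurable X]setTI; apply: measurable_fst => //.
    exact: measurableC.
  have m2 : measurable A2.
    rewrite -[X in measurable X]setTI; apply: measurable_snd => //.
    exact: measurableC.
  have e1 : Pi A1 = 0%E.
    apply: etrans (Pi1 _ (measurableC mXi)) _.
    exact: complement_null empirical_Xi.
  have e2 : Pi A2 = 0%E.
    apply: etrans (Pi2 _ (measurableC mXi)) _.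
    exact: complement_null (proj1 Pfm).
  have e12 : (Pi A1 + Pi A2 <= 0)%E by rewrite e1 e2 adde0.
  apply: le_trans (le_trans (measureU2 Pi m1 m2) e12).
  apply: le_measure; rewrite ?inE; [exact: measurableC|exact: measurableU|].
  move=> [x y]/= xy; apply: contrapT => /not_orP[/contrapT ? /contrapT ?].
  exact: xy.
have DXX : (\int[Pi]_z (D z)%:E < (eps + e / (L + 1))%:E)%E.
  rewrite (ge0_negligible_integral (measurableC mXX) measurableT mD)//.
  - by rewrite setTD setCK.
  - by move=> z _; exact: D0.
have Di : Pi.-integrable setT (EFin \o D).
  apply/integrableP; split => //.
  rewrite (eq_integral (EFin \o D)); last first.
    by move=> z _; rewrite /= ger0_norm// vnorm_ge0.
  by rewrite (lt_trans DXX)// ltry.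
have f1 := marginal_integrable (@measurable_fst _ _ _ _) Pi1 S0i.
have f2 := marginal_integrable (@measurable_snd _ _ _ _) Pi2 Si.
have LDi : Pi.-integrable setT (fun z => L%:E * (EFin \o D) z)%E.
  exact: integrableZl.
have : (\int[Pi]_z (S z.2)%:E <= \int[Pi]_z ((S z.1)%:E + L%:E * (D z)%:E))%E.
  apply: le_integral => //; first exact: integrableD.
  move=> z _; rewrite -EFinM -EFinD lee_fin.
  by have := SL z.2 z.1; rewrite (vnormBC hnrm) lerBlDl.
rewrite -(marginal_integral (@measurable_snd _ _ _ _) Pi2 Si).
rewrite integralD// -(marginal_integral (@measurable_fst _ _ _ _) Pi1 S0i).
rewrite integral_empirical// integralZl// => /le_trans; apply.
have LD : (L%:E * \int[Pi]_z (EFin \o D) z <= (L * eps + e)%:E)%E.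
  apply: (@le_trans _ _ (L%:E * (eps + e / (L + 1))%:E)%E).
    by rewrite lee_wpmul2l ?lee_fin// ltW.
  rewrite -EFinM lee_fin mulrDr lerD2l mulrCA ler_piMr ?(ltW e0)//.
  by rewrite ler_pdivrMr// mul1r lerDl.
apply: (le_trans (leeD2l _ LD)).
by rewrite -!EFinD lee_fin; lra.
Qed.

(** Distributions in the ball charge only [Xi], so a majorant on [Xi] suffices. *)
Lemma worst_case_expectation_le eps (f S : 'cV[R]_m -> R) K L : 0 <= L ->
  (forall x y, f x - f y <= K * nrm (x - y)) ->
  (forall x y, S x - S y <= L * nrm (x - y)) ->
  (forall x, Xi x -> f x <= S x) ->
  (worst_case_expectation Xi nrm P0 eps (EFin \o f) <=
   (L * eps + N%:R^-1 * \sum_(i < N) S (xihat i))%:E)%E.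
Proof.
move=> L0 fK SL fS; apply: ge_ereal_sup => _ [P ballP <-].
apply: le_trans (lipschitz_expectation_le L0 ballP SL).
have [PXi _] := proj1 ballP.
have fi := lipschitz_integrable (proj1 ballP) fK.
have Si := lipschitz_integrable (proj1 ballP) SL.
have toXi g : P.-integrable setT g -> (\int[P]_x g x = \int[P]_(x in Xi) g x)%E.
  move=> gi; rewrite (negligible_integral (measurableC mXi) measurableT gi).
    by rewrite setTD setCK.
  exact: complement_null.
have fXi := integrableS measurableT mXi (@subsetT _ _) fi.
have SXi := integrableS measurableT mXi (@subsetT _ _) Si.
rewrite toXi// [leRHS]toXi//; apply: (le_integral mXi fXi SXi).
by move=> x; rewrite inE => /fS; rewrite lee_fin.
Qed.

End wasserstein_theory.

(** * Fan's minimax theorem *)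

Section minimax.
Context (R : realType) (T : topologicalType) (P : Type) (B : set P).
Context (f : T -> P -> R) (r : R).

Definition concavelike (A : set T) := forall u0 u1 t, A u0 -> A u1 ->
  0 <= t <= 1 -> exists2 u, A u &
    forall p, B p -> (1 - t) * f u0 p + t * f u1 p <= f u p.

Definition convexlike (A : set T) := forall p0 p1 t, B p0 -> B p1 ->
  0 <= t <= 1 -> exists2 p, B p &
    forall u, A u -> f u p <= (1 - t) * f u p0 + t * f u p1.

Hypothesis f_cont : forall p, B p -> continuous (f^~ p).

(** Minimise the sum of the two squared shortfalls below [r]. If the minimum is
    positive, its first-order condition says that the shortfalls, used as
    weights, make a convex combination of [p] and [q] whose payoff stays below
    [r] on all of [A]. *)
Lemma minimax_pair A p q : compact A -> concavelike A -> convexlike A ->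
  (forall p, B p -> exists2 u, A u & r <= f u p) -> B p -> B q ->
  exists u, [/\ A u, r <= f u p & r <= f u q].
Proof.
move=> cA ccA cvA hr Bp Bq.
pose gap u p := Num.max 0 (r - f u p).
pose phi u := gap u p ^+ 2 + gap u q ^+ 2.
have gap_cont p' : B p' -> continuous (fun u => gap u p' ^+ 2).
  move=> Bp' u; apply: (@continuous_comp _ _ _ (gap^~ p') (fun x => x ^+ 2)).
    apply: (@continuous_max _ _ (fun=> 0) (fun u => r - f u p')).
      exact: cst_continuous.
    apply: (@continuousB _ _ _ (fun=> r) (f^~ p')); last exact: f_cont.
    exact: cst_continuous.
  exact: exprn_continuous.
have phi_cont : continuous phi.
  move=> u; apply: (@continuousD _ _ _ (fun u => gap u p ^+ 2)
    (fun u => gap u q ^+ 2)); exact: gap_cont.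
have [u0 Au0 umin] : exists2 u, u \in A & forall v, v \in A -> phi u <= phi v.
  apply: compact_EVT_min => //; last exact: continuous_subspaceT.
  by have [u Au _] := hr p Bp; exists u.
rewrite inE in Au0.
set a := gap u0 p; set b := gap u0 q.
have ge0 p' : 0 <= gap u0 p' by rewrite le_max lexx.
have gapr p' : r - f u0 p' <= gap u0 p' by rewrite le_max lexx orbT.
have gapM p' : gap u0 p' * f u0 p' = gap u0 p' * (r - gap u0 p').
  rewrite /gap; case: (leP 0 (r - f u0 p')) => _; last by rewrite !mul0r.
  by rewrite subKr.
have a0 : 0 <= a := ge0 p; have b0 : 0 <= b := ge0 q.
have [ab0|ab0] := leP (a + b) 0.
  exists u0; split=> //.
    by have := gapr p; rewrite -/a; lra.
  by have := gapr q; rewrite -/b; lra.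
have [|p' Bp' p'le] := cvA p q (b / (a + b)) Bp Bq.
  by rewrite divr_ge0 ?(ltW ab0)// ler_pdivrMr// mul1r lerDr a0.
have [u1 Au1 u1r] := hr p' Bp'.
have {p'le}u1le : (a + b) * r <= a * f u1 p + b * f u1 q.
  have := le_trans u1r (p'le _ Au1).
  rewrite -(ler_pM2l ab0) => /le_trans; apply.
  rewrite le_eqVlt; apply/orP; left; apply/eqP; field.
  by rewrite gt_eqF.
pose x := f u1 p - f u0 p; pose y := f u1 q - f u0 q.
pose G := a * x + b * y.
have Gpos : 0 < G.
  have := gapM p; have := gapM q; rewrite -/a -/b /G /x /y => hb ha.
  have a2b2 : 0 < a * a + b * b.
    have := mulr_gt0 ab0 ab0; have := sqr_ge0 (a - b).
    by rewrite expr2; nra.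
  rewrite !mulrBr in ha hb *; move: u1le; rewrite mulrDl; lra.
(* Along the segment from [u0] to [u1] the sum of squares changes by at most
   [- 2 * t * G + t ^+ 2 * S]; the step [t] below makes this negative. *)
pose S := x ^+ 2 + y ^+ 2.
have S0 : 0 <= S by rewrite addr_ge0 ?sqr_ge0.
have SG : 0 < S + G by rewrite ltr_wpDl.
pose t := G / (S + G).
have t0 : 0 < t by rewrite divr_gt0.
have tSG : t * (S + G) = G by rewrite /t divfK// gt_eqF.
have [|u Au ule] := ccA u0 u1 t Au0 Au1.
  by rewrite (ltW t0) /t ler_pdivrMr// mul1r lerDr.
have gap_le s z : B s -> z = f u1 s - f u0 s ->
    gap u s ^+ 2 <= (gap u0 s - t * z) ^+ 2.
  move=> Bs ->.
  have h : r - f u s <= gap u0 s - t * (f u1 s - f u0 s).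
    by have := ule _ Bs; have := gapr s; lra.
  rewrite [X in X ^+ 2 <= _]/gap; case: (leP 0 (r - f u s)) => h'.
    by rewrite ler_sqr ?nnegrE// (le_trans h').
  by rewrite expr0n/= sqr_ge0.
have : phi u0 <= phi u by apply: umin; rewrite inE.
have := gap_le p x Bp erefl; have := gap_le q y Bq erefl.
rewrite /phi -/a -/b.
move: (gap u p) (gap u q) => c d hd hc hphi.
have : 2 * t * G <= t ^+ 2 * S.
  by rewrite /G /S; nra.
have -> : t ^+ 2 * S = t * G - t * (t * G).
  by rewrite -{1}tSG; ring.
have := mulr_gt0 t0 Gpos => tG; have := mulr_gt0 t0 tG.
by lra.
Qed.

(** By induction on the finite family: restricting [A] to a superlevel set of
    one payoff preserves the hypotheses, the last of them by [minimax_pair]. *)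
Lemma minimax_seq A (s : seq {classic P}) : compact A -> concavelike A ->
  convexlike A -> (forall p, B p -> exists2 u, A u & r <= f u p) ->
  A !=set0 -> {in s, forall p, B p} ->
  exists2 u, A u & {in s, forall p, r <= f u p}.
Proof.
elim: s A => [|p s IH] A cA ccA cvA hr A0 sB.
  by case: A0 => u Au; exists u.
have Bp : B p by apply: sB; rewrite mem_head.
have {}sB : {in s, forall p, B p}.
  by move=> q qs; apply: sB; rewrite inE qs orbT.
pose A' := A `&` [set u | r <= f u p].
have [||||||u [Au ur] us] := IH A'.
- apply: compact_closedI => //; apply: (@preimage_closed _ _ (f^~ p) [set t | r <= t]).
    by move=> u _; exact: f_cont.
  exact: closed_ge.
- move=> u0 u1 t [Au0 u0r] [Au1 u1r] t01.
  have [u Au ule] := ccA u0 u1 t Au0 Au1 t01.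
  exists u => //; split=> //=; apply: le_trans (ule _ Bp).
  by have /andP[? ?] := t01; rewrite /= in u0r u1r; nra.
- move=> p0 p1 t Bp0 Bp1 t01.
  have [q Bq qle] := cvA p0 p1 t Bp0 Bp1 t01.
  by exists q => // u [Au _]; exact: qle.
- move=> q Bq; have [u [Au up uq]] := minimax_pair cA ccA cvA hr Bp Bq.
  by exists u.
- have [u Au up] := hr p Bp; by exists u.
- exact: sB.
by exists u => // q; rewrite inE => /predU1P[->|/us].
Qed.

(** Finite families of superlevel sets meet by [minimax_seq], hence all of them
    do by compactness. The payoff is only asked to be concave-like and
    convex-like, so that neither side needs a linear structure: plans and
    multipliers below are families of pairs. *)
Lemma minimax A : compact A -> A !=set0 -> concavelike A -> convexlike A ->
  (forall p, B p -> exists2 u, A u & r <= f u p) ->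
  exists2 u, A u & forall p, B p -> r <= f u p.
Proof.
move=> cA A0 ccA cvA hr.
have [[p0 Bp0]|nB] := pselect (B !=set0); last first.
  by case: A0 => u Au; exists u => // p Bp; case: nB; exists p.
pose F (p : {classic P}) := A `&` [set u | r <= f u p].
(* The finite intersection property is stated for pointed spaces; [A]
   provides a point. *)
have [u1 _] := A0.
pose T' : ptopologicalType := HB.pack (Topological.sort T) (isPointed.Build T u1).
have : \bigcap_(p in (B : set {classic P})) F p !=set0.
  have : @compact T' A := cA.
  rewrite compact_In0; apply.
    exists (fun p => [set u | r <= f u p]) => // p Bp.
    apply: (@preimage_closed _ _ (f^~ p) [set t | r <= t]); last exact: closed_ge.
    by move=> u _; exact: f_cont.
  move=> D DB.
  have [p pD|u Au us] := minimax_seq (s := finmap.enum_fset D) cA ccA cvA hr A0.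
    exact/set_mem/DB.
  by exists u => p pD; split=> //; exact: us.
move=> [u uF]; exists u => [|p Bp]; first by case: (uF p0 Bp0).
by case: (uF p Bp).
Qed.

End minimax.

(** * Duality for maxima of concave losses *)

Section maxmin_duality.
Context (R : realType) (m : nat) (nrm : 'cV[R]_m -> R) (hnrm : vector_norm nrm).
Context (p : nat) (C : 'M[R]_(p, m)) (d : 'cV[R]_p).
Context (N : nat) (hN : (0 < N)%N) (xihat : 'I_N -> 'cV[R]_m).
Hypothesis hxihat : forall i, polyhedron C d (xihat i).
Context (eps : R) (heps : 0 <= eps).
Local Notation P0 := (empirical xihat hN).

(** A pair (z, c) encodes the affine function <z, .> + c. *)
Definition affval (a : 'cV[R]_m * R) (xi : 'cV[R]_m) := dotv a.1 xi + a.2.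

(** The loss is the maximum over [k] of the attained minima over [A k]. Of the
    two inequalities between the loss and the pieces, [l_pieces] bounds the loss
    from below at the atoms of a distribution and [l_active] from above by a
    dual point. *)
Context (K : nat) (A : 'I_K -> set ('cV[R]_m * R)) (l : 'cV[R]_m -> R).
Hypothesis A_convex : forall k a b t, A k a -> A k b -> 0 <= t <= 1 ->
  A k ((1 - t) *: a.1 + t *: b.1, (1 - t) * a.2 + t * b.2).
Hypothesis A_bounded :
  exists L, forall k a, A k a -> forall x, dotv a.1 x <= L * nrm x.
Hypothesis l_pieces : forall k xi, exists a,
  [/\ A k a, forall b, A k b -> affval a xi <= affval b xi & affval a xi <= l xi].
Hypothesis l_active : forall xi, exists k, forall a, A k a -> l xi <= affval a xi.

Definition dual_feasible_point (lambda : R) (s : 'I_N -> R)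
    (gamma : 'I_N * 'I_K -> 'cV[R]_p) (a : 'I_N * 'I_K -> 'cV[R]_m * R) :=
  [/\ forall j, A j.2 (a j),
      forall j, affval (a j) (xihat j.1)
        + dotv (gamma j) (d - C *m xihat j.1) <= s j.1,
      forall j, (dual_norm nrm ((a j).1 - C^T *m gamma j) <= lambda%:E)%E &
      forall j, lev 0 (gamma j)].

Let k0 : 'I_K := sval (cid (l_active 0)).
Let i0 : 'I_N := Ordinal hN.

Lemma maxmin_lipschitz : exists L, forall x y, l x - l y <= L * nrm (x - y).
Proof.
have [L LP] := A_bounded; exists L => x y.
have [k kx] := l_active x; have [a [Aa _ ay]] := l_pieces k y.
have := LP k a Aa (x - y); have := kx a Aa.
by move: ay; rewrite /affval dotvBr; lra.
Qed.

(** Weak duality: a dual point makes the lower envelope of the cones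
    s_i + lambda |x - xihat_i| a Lipschitz majorant of the loss on the
    polyhedron. *)
Lemma maxmin_weak_duality lambda s gamma a :
  dual_feasible_point lambda s gamma a ->
  (worst_case_expectation (polyhedron C d) nrm P0 eps (EFin \o l)
   <= (lambda * eps + N%:R^-1 * \sum_(i < N) s i)%:E)%E.
Proof.
move=> [Aa as_ al g0].
have lP j := (dual_norm_leP hnrm _ _).1 (al j).
have l0 : 0 <= lambda := (lP (i0, k0)).1.
pose cone x i := s i + lambda * nrm (x - xihat i).
pose am x := [arg min_(i < i0) cone x i]%O.
have amP x i : cone x (am x) <= cone x i.
  by rewrite /am; case: arg_minP => // j _ /(_ i isT).
pose S x := cone x (am x).
have SL x y : S x - S y <= lambda * nrm (x - y).
  rewrite lerBlDr (le_trans (amP x (am y)))// /S /cone addrCA lerD2l -mulrDr.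
  by rewrite ler_wpM2l// vnorm_distD.
have [L lL] := maxmin_lipschitz.
apply: (@le_trans _ _ (lambda * eps + N%:R^-1 * \sum_(i < N) S (xihat i))%:E).
  apply: (worst_case_expectation_le hnrm (@polyhedron_closed _ _ _ C d)
    hN hxihat eps l0 lL SL) => x Xx.
  rewrite /S; set i := am x.
  have [k kx] := l_active x; apply: le_trans (kx _ (Aa (i, k))) _.
  have := (lP (i, k)).2 (x - xihat i); have := as_ (i, k).
  have : 0 <= dotv (gamma (i, k)) (d - C *m x).
    by apply: dotv_ge0; [exact: g0|exact: (lev_subr _ _).1 Xx].
  rewrite /cone /affval/= !dotvBr !dotvBl !dotv_trmx; lra.
rewrite lee_fin lerD2l ler_wpM2l ?invr_ge0// ler_sum// => i _.
by rewrite (le_trans (amP _ i))// /cone subrr vnorm0// mulr0 addr0.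
Qed.

(** A transport plan splits the unit mass of the i-th data point into the
    masses [(u (i, k)).1], and [(u (i, k)).2] is the mass times the
    displacement; in these variables the problem is concave. *)
Local Notation plan := {ptws ('I_N * 'I_K) -> (R * 'cV[R]_m)%type}.

Definition plans : set plan := [set u |
  (forall j, 0 <= (u j).1) /\ (forall i, \sum_k (u (i, k)).1 = 1) /\
  \sum_j nrm (u j).2 <= N%:R * eps].

Definition dual_var := (('I_N * 'I_K -> 'cV[R]_p) *
  ('I_N * 'I_K -> 'cV[R]_m * R))%type.

Definition dual_vars : set dual_var := [set q |
  (forall j, lev 0 (q.1 j)) /\ (forall j, A j.2 (q.2 j))].

(** The expected Lagrangian of the transported distribution, written so that it
    also makes sense for vanishing masses. *)
Definition payoff (u : plan) (q : dual_var) : R := N%:R^-1 * \sum_j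
  ((u j).1 * (affval (q.2 j) (xihat j.1) + dotv (q.1 j) (d - C *m xihat j.1))
   + dotv ((q.2 j).1 - C^T *m q.1 j) (u j).2).

Lemma plan_coord_continuous j : continuous (fun u : plan => u j).
Proof. exact: (@proj_continuous _ (fun=> (R * 'cV[R]_m)%type) j). Qed.

Lemma plan_mass_continuous j : continuous (fun u : plan => (u j).1).
Proof.
move=> u; apply: (@continuous_comp _ _ _ (fun u : plan => u j) fst).
  exact: plan_coord_continuous.
exact: cvg_fst.
Qed.

Lemma plan_shift_continuous j : continuous (fun u : plan => (u j).2).
Proof.
move=> u; apply: (@continuous_comp _ _ _ (fun u : plan => u j) snd).
  exact: plan_coord_continuous.
exact: cvg_snd.
Qed.

Lemma payoff_continuous q : continuous (payoff^~ q).
Proof.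
move=> u; apply: (@continuousM _ _ (fun=> _) (fun u : plan => \sum_j _)).
  exact: cst_continuous.
apply: continuous_sum => j {}u; apply: (@continuousD _ _ _
   (fun u : plan => (u j).1 * _) (fun u : plan => dotv _ (u j).2)).
  apply: (@continuousM _ _ (fun u : plan => (u j).1) (fun=> _)).
    exact: plan_mass_continuous.
  exact: cst_continuous.
apply: (@continuous_comp _ _ _ (fun u : plan => (u j).2) (dotv _)).
  exact: plan_shift_continuous.
exact: dotv_continuous.
Qed.

Lemma plans_compact : compact plans.
Proof.
pose box (_ : 'I_N * 'I_K) : set (R * 'cV[R]_m) :=
  `[0, 1] `*` [set x | nrm x <= N%:R * eps].
have cbox : compact [set u : plan | forall j, box j (u j)].
  apply: (@tychonoff _ _ box) => j; apply: compact_setX.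
    exact: segment_compact.
  exact: vnorm_ball_compact.
apply: subclosed_compact cbox _; last first.
  move=> u [u0 [u1 ue]] [i k]; split=> /=.
    have le1 : (u (i, k)).1 <= \sum_k' (u (i, k')).1.
      by rewrite (bigD1 k)//= lerDl sumr_ge0.
    by rewrite in_itv/= u0/= -(u1 i).
  rewrite (le_trans _ ue)// (bigD1 (i, k))//= lerDl sumr_ge0// => j _.
  exact: vnorm_ge0.
rewrite (_ : plans = \bigcap_j [set u : plan | 0 <= (u j).1] `&`
  (\bigcap_i [set u : plan | \sum_k (u (i, k)).1 = 1] `&`
   [set u : plan | \sum_j nrm (u j).2 <= N%:R * eps])); last first.
  apply/seteqP; split=> u [u0 [u1 ue]].
    by split; [move=> j _; exact: u0|split=> // i _; exact: u1].
  by split; [move=> j; exact: u0|split=> // i; exact: u1].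
apply: closedI; last apply: closedI.
- apply: closed_bigI => j _.
  apply: (@preimage_closed _ _ (fun u : plan => (u j).1) [set t | 0 <= t]).
    by move=> u _; exact: plan_mass_continuous.
  exact: closed_ge.
- apply: closed_bigI => i _.
  apply: (@preimage_closed _ _ (fun u : plan => \sum_k (u (i, k)).1) [set 1]).
    move=> u _; apply: continuous_sum => k; exact: plan_mass_continuous.
  exact: closed_eq.
- apply: (@preimage_closed _ _ (fun u : plan => \sum_j nrm (u j).2)
    [set t | t <= N%:R * eps]); last exact: closed_le.
  move=> u _; apply: continuous_sum => j {}u.
  apply: (@continuous_comp _ _ _ (fun u : plan => (u j).2) nrm).
    exact: plan_shift_continuous.
  exact: vnorm_continuous.
Qed.

Definition mix_plan t (u0 u1 : plan) : plan := fun j =>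
  ((1 - t) * (u0 j).1 + t * (u1 j).1, (1 - t) *: (u0 j).2 + t *: (u1 j).2).

Lemma mix_plans t u0 u1 : plans u0 -> plans u1 -> 0 <= t <= 1 ->
  plans (mix_plan t u0 u1).
Proof.
move=> [p0 [m0 e0]] [p1 [m1 e1]] /andP[t0 t1].
have t1' : 0 <= 1 - t by rewrite subr_ge0.
split=> [j|]; first by rewrite addr_ge0 ?mulr_ge0.
split=> [i|]; first by rewrite big_split/= -!mulr_sumr m0 m1; lra.
apply: (@le_trans _ _ (\sum_j ((1 - t) * nrm (u0 j).2 + t * nrm (u1 j).2))).
  apply: ler_sum => j _; rewrite (le_trans (vnorm_triangle hnrm _ _))//.
  by rewrite !(vnorm_homogeneous hnrm) !ger0_norm.
rewrite big_split/= -!mulr_sumr.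
by move: e0 e1; move: (\sum_j _) (\sum_j _) (_ * eps) => x y z; nra.
Qed.

Lemma payoff_mix t u0 u1 q :
  payoff (mix_plan t u0 u1) q = (1 - t) * payoff u0 q + t * payoff u1 q.
Proof.
rewrite /payoff mulrCA [t * _]mulrCA -mulrDr; congr (_ * _).
rewrite !mulr_sumr -big_split/=; apply: eq_bigr => j _.
rewrite /mix_plan/= [dotv _ (_ + _ *: _)]dotvDr !dotvZr; ring.
Qed.

Lemma payoff_convexlike (U : set plan) : convexlike dual_vars payoff U.
Proof.
move=> [g0 a0] [g1 a1] t [/= g0p a0p] [/= g1p a1p] t01.
exists (fun j => (1 - t) *: g0 j + t *: g1 j, fun j =>
   ((1 - t) *: (a0 j).1 + t *: (a1 j).1, (1 - t) * (a0 j).2 + t * (a1 j).2)).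
  split=> j /=; last exact: A_convex.
  move: t01 => /andP[t0 t1] i; have := g0p j i; have := g1p j i.
  by rewrite !mxE => *; rewrite addr_ge0// mulr_ge0// subr_ge0.
move=> u _; rewrite le_eqVlt; apply/orP; left; apply/eqP.
rewrite /payoff mulrCA [t * _]mulrCA -mulrDr; congr (_ * _).
rewrite !mulr_sumr -big_split/=; apply: eq_bigr => j _.
rewrite /affval/= !dotvDl !dotvNl !dotv_trmx !dotvDl !dotvZl; ring.
Qed.

Let sum_pair (F : 'I_N * 'I_K -> R) : \sum_j F j = \sum_i \sum_k F (i, k).
Proof. by rewrite pair_bigA/=; apply: eq_bigr => -[]. Qed.

(** Against fixed multipliers, the best plan puts the mass of each data point
    on its largest constraint and spends the whole transport budget on the one
    displacement that attains the largest dual norm. *)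
Lemma payoff_ge_dual r :
  (forall lambda s gamma a, dual_feasible_point lambda s gamma a ->
    r <= lambda * eps + N%:R^-1 * \sum_(i < N) s i) ->
  forall q, dual_vars q -> exists2 u, plans u & r <= payoff u q.
Proof.
move=> hr [g a] [/= g0 Aa].
pose rho j := affval (a j) (xihat j.1) + dotv (g j) (d - C *m xihat j.1).
pose z j := (a j).1 - C^T *m g j.
pose kap i := [arg max_(k > k0) rho (i, k)]%O.
have kapP i k : rho (i, k) <= rho (i, kap i).
  by rewrite /kap; case: arg_maxP => // k' _ /(_ k isT).
have xP j := dual_norm_attained hnrm (z j).
pose x j := sval (cid2 (xP j)).
have x1 j : nrm (x j) <= 1 by exact: (s2valP (cid2 (xP j))).
have xz j : 0 <= dotv (z j) (x j) /\
    (dual_norm nrm (z j) <= (dotv (z j) (x j))%:E)%E.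
  exact: (s2valP' (cid2 (xP j))).
pose js := [arg max_(j > (i0, k0)) dotv (z j) (x j)]%O.
have jsP j : dotv (z j) (x j) <= dotv (z js) (x js).
  by rewrite /js; case: arg_maxP => // j' _ /(_ j isT).
exists (fun j => ((j.2 == kap j.1)%:R,
                  if j == js then (N%:R * eps) *: x j else 0)).
  split=> [j|]; first exact: ler0n.
  split=> [i|].
    rewrite (bigD1 (kap i))//= eqxx big1 ?addr0// => k kk.
    by rewrite (negbTE kk).
  rewrite (bigD1 js)//= eqxx big1 ?addr0 => [|j /negbTE ->]; last exact: vnorm0.
  by rewrite (vnorm_homogeneous hnrm) ger0_norm ?mulr_ge0// ler_piMr// mulr_ge0.
apply: le_trans (hr (dotv (z js) (x js)) (fun i => rho (i, kap i)) g a _) _.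
  split=> //= j; first by case: j => i k; exact: kapP.
  by apply: le_trans (xz j).2 _; rewrite lee_fin.
rewrite [leLHS]addrC /payoff [X in _ <= _ * X]big_split [leRHS]mulrDr.
apply: lerD => /=.
  rewrite ler_wpM2l ?invr_ge0// sum_pair ler_sum// => i _.
  rewrite (bigD1 (kap i))//= eqxx mul1r big1 ?addr0// => k kk.
  by rewrite (negbTE kk) mul0r.
rewrite (bigD1 js)//= eqxx big1 => [|j /negbTE ->]; last exact: dotv0.
by rewrite addr0 dotvZr mulrA mulKf ?pnatr_eq0 -?lt0n// mulrC.
Qed.

(** Positive masses turn the payoff into the expected Lagrangian of a discrete
    distribution with atoms xihat_i + w_ik / alpha_ik. *)
Lemma payoff_scaled (u : plan) q : (forall j, 0 < (u j).1) ->
  payoff u q = N%:R^-1 * \sum_j (u j).1 *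
    (affval (q.2 j) (xihat j.1 + (u j).1^-1 *: (u j).2)
     + dotv (q.1 j) (d - C *m (xihat j.1 + (u j).1^-1 *: (u j).2))).
Proof.
move=> u0; congr (_ * _); apply: eq_bigr => j _.
rewrite /affval mulmxDr -scalemxAr !dotvBr !dotvDr !dotvZr dotvBl dotv_trmx.
have un0 : (u j).1 != 0 by rewrite gt_eqF.
by field.
Qed.

(** A plan with positive masses that guarantees payoff [r] is a discrete
    distribution in the ball: large multipliers force its atoms into the
    polyhedron, and zero multipliers bound its expected loss from below. *)
Lemma positive_plan_expectation (u : plan) r : plans u -> (forall j, 0 < (u j).1) ->
  (forall q, dual_vars q -> r <= payoff u q) ->
  (r%:E <= worst_case_expectation (polyhedron C d) nrm P0 eps (EFin \o l))%E.
Proof.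
move=> [_ [u1 ue]] u0 hr.
have N0 : 0 < N%:R^-1 :> R by rewrite invr_gt0 ltr0n.
pose y j := xihat j.1 + (u j).1^-1 *: (u j).2.
have aP j := l_pieces j.2 (y j).
pose a j := sval (cid (aP j)).
have [Aa al] : (forall j, A j.2 (a j)) /\ (forall j, affval (a j) (y j) <= l (y j)).
  by split=> j; case: (svalP (cid (aP j))).
have yX j : polyhedron C d (y j).
  move=> i; rewrite leNgt; apply/negP => neg.
  pose e := N%:R^-1 * ((u j).1 * (d - C *m y j) i 0).
  have e0 : e < 0.
    have : (d - C *m y j) i 0 < 0 by rewrite mxE [X in _ + X]mxE subr_lt0.
    by rewrite /e (pmulr_rlt0 _ N0) (pmulr_rlt0 _ (u0 j)).
  pose g M j' : 'cV[R]_p := if j' == j then M *: delta_mx i 0 else 0.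
  have gB M : 0 <= M -> dual_vars (g M, a).
    move=> M0; split=> //= j' i'; rewrite /g; case: ifP => _; rewrite !mxE//.
    by rewrite mulr_ge0// ler0n.
  pose c := N%:R^-1 * \sum_j (u j).1 * affval (a j) (y j).
  have gE M : payoff u (g M, a) = c + M * e.
    rewrite payoff_scaled//= /c /e (eq_bigr (fun j => (u j).1 * affval (a j) (y j)
        + (u j).1 * dotv (g M j) (d - C *m y j))); last first.
      by move=> j' _; rewrite mulrDr.
    rewrite big_split/= mulrDr; congr (_ + _); rewrite mulrCA; congr (_ * _).
    rewrite (bigD1 j)//= big1 ?addr0 => [|j' /negbTE jj]; last first.
      by rewrite /g jj dot0v mulr0.
    by rewrite /g eqxx dotvZl dotv_delta mulrCA.
  (* Large enough for the violated constraint to push the payoff below r. *)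
  pose M := (`|c - r| + 1) / - e.
  have M0 : 0 <= M by rewrite divr_ge0 ?addr_ge0// oppr_ge0 ltW.
  have Me : M * e = - (`|c - r| + 1).
    by rewrite /M invrN mulrN mulNr divfK// lt_eqF.
  have := hr _ (gB M M0); rewrite gE Me.
  by have := ler_norm (c - r); lra.
pose w j := N%:R^-1 * (u j).1.
have w0 j : 0 <= w j by rewrite mulr_ge0 ?ltW.
have wi i : \sum_(j | j.1 == i) w j = N%:R^-1.
  transitivity (\sum_k w (i, k)); last by rewrite -mulr_sumr u1 mulr1.
  rewrite (reindex_onto (fun k => (i, k)) snd)/=; last first.
    by move=> [i' k] /eqP/= ->.
  by apply: eq_bigl => k; rewrite !eqxx.
have w1 : \sum_j w j = 1.
  rewrite sum_pair (eq_bigr (fun=> N%:R^-1)); last first.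
    by move=> i _; rewrite -mulr_sumr u1 mulr1.
  by rewrite sumr_const card_ord -[LHS]mulr_natr mulVf// pnatr_eq0 -lt0n.
have [L lL] := maxmin_lipschitz.
have cost : \sum_j w j * nrm (xihat j.1 - y j) <= eps.
  rewrite (eq_bigr (fun j => N%:R^-1 * nrm (u j).2)); last first.
    move=> j _; rewrite /w /y opprD addrA subrr sub0r vnormN//.
    rewrite (vnorm_homogeneous hnrm) ger0_norm ?invr_ge0 ?(ltW (u0 j))//.
    by rewrite -mulrA mulVKf// gt_eqF.
  by rewrite -mulr_sumr ler_pdivrMl// ltr0n.
apply: le_trans (worst_case_expectation_ge hnrm (@polyhedron_closed _ _ _ C d)
  hN w0 w1 wi (lipschitz_continuous hnrm lL) yX cost).
rewrite lee_fin; apply: (@le_trans _ _ (payoff u (fun=> 0, a))).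
  by apply: hr; split=> //= j i; rewrite mxE.
rewrite payoff_scaled//= mulr_sumr ler_sum// => j _.
by rewrite dot0v addr0 mulrA; apply: ler_wpM2l; [exact: w0|exact: al].
Qed.

(** The minimax theorem turns [payoff_ge_dual] into one plan for all
    multipliers, and [positive_plan_expectation] applies to its perturbations. *)
Lemma maxmin_strong_duality r :
  (forall lambda s gamma a, dual_feasible_point lambda s gamma a ->
    r <= lambda * eps + N%:R^-1 * \sum_(i < N) s i) ->
  (r%:E <= worst_case_expectation (polyhedron C d) nrm P0 eps (EFin \o l))%E.
Proof.
move=> /payoff_ge_dual hr.
have K0 : 0 < K%:R^-1 :> R by rewrite invr_gt0 ltr0n (leq_trans _ (ltn_ord k0)).
pose unif : plan := fun=> (K%:R^-1, 0).
have unifP : plans unif.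
  split=> [j|]; first exact: ltW.
  split=> [i|].
    by rewrite sumr_const card_ord -[LHS]mulr_natr mulVf// -invr_eq0 gt_eqF.
  by rewrite big1 ?mulr_ge0// => j _; exact: vnorm0.
have concave : concavelike dual_vars payoff plans.
  move=> u0 u1 t p0 p1 t01; exists (mix_plan t u0 u1); first exact: mix_plans.
  by move=> q _; rewrite payoff_mix.
have [u uP ur] : exists2 u, plans u & forall q, dual_vars q -> r <= payoff u q.
  apply: (minimax _ plans_compact (ex_intro _ _ unifP) concave
    (@payoff_convexlike plans) hr).
  by move=> q _; exact: payoff_continuous.
have bP j := l_pieces j.2 (xihat j.1).
pose b := N%:R^-1 * \sum_j K%:R^-1 * affval (sval (cid (bP j))) (xihat j.1).
have unif_ge q : dual_vars q -> b <= payoff unif q.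
  move=> [g0 Aq]; rewrite /b /payoff ler_wpM2l ?invr_ge0// ler_sum// => j _.
  rewrite /unif/= dotv0 addr0 ler_wpM2l ?(ltW K0)//.
  case: (svalP (cid (bP j))) => _ bmin _.
  rewrite (le_trans (bmin _ (Aq j)))// lerDl dotv_ge0//.
  exact: (lev_subr _ _).1 (hxihat j.1).
(* Mixing in the uniform plan makes all masses positive: without it, a
   displacement could carry no mass and escape to infinity. *)
apply/lee_addgt0Pr => e e0.
(* Any weight in ]0, 1] with [t * (r - b) <= e] would do. *)
pose t := e / (`|r - b| + 1 + e).
have D0 : 0 < `|r - b| + 1 + e by rewrite addr_gt0// ltr_wpDl.
have t0 : 0 < t by rewrite divr_gt0.
have t1 : t <= 1 by rewrite ler_pdivrMr// mul1r lerDr addr_ge0.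
have tE : t * (`|r - b| + 1 + e) = e by rewrite /t divfK// gt_eqF.
have t01 : 0 <= t <= 1 by rewrite (ltW t0).
have r'le : r <= (1 - t) * r + t * b + e.
  by have := ler_norm (r - b); nra.
have step : (((1 - t) * r + t * b)%:E <=
    worst_case_expectation (polyhedron C d) nrm P0 eps (EFin \o l))%E.
  apply: (@positive_plan_expectation (mix_plan t u unif)).
  - exact: mix_plans.
  - move=> j; apply: ltr_wpDl (mulr_gt0 t0 K0).
    by apply: mulr_ge0; [rewrite subr_ge0|exact: uP.1].
  - move=> q Bq; rewrite payoff_mix lerD// ler_wpM2l ?subr_ge0// ?(ltW t0)//.
      exact: ur.
    exact: unif_ge.
apply: (@le_trans _ _ ((1 - t) * r + t * b + e)%:E); first by rewrite lee_fin.
by rewrite EFinD leeD2r.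
Qed.

Theorem maxmin_duality :
  worst_case_expectation (polyhedron C d) nrm P0 eps (EFin \o l) =
  ereal_inf [set v | exists lambda s gamma a,
    dual_feasible_point lambda s gamma a /\
    v = (lambda * eps + N%:R^-1 * \sum_(i < N) s i)%:E].
Proof.
apply/eqP; rewrite eq_le; apply/andP; split.
  apply: le_ereal_inf_tmp => _ [lambda [s [g [a [dfp ->]]]]].
  exact: maxmin_weak_duality dfp.
set I := ereal_inf _; set W := worst_case_expectation _ _ _ _ _.
have rW r : (r%:E <= I)%E -> (r%:E <= W)%E.
  move=> rI; apply: maxmin_strong_duality => lambda s g a dfp.
  rewrite -lee_fin (le_trans rI)//; apply: ereal_inf_lbound.
  by exists lambda, s, g, a.
case E : I rW => [r||] rW; [exact: rW| |exact: leNye].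
by have -> : W = +oo%E by apply/eqyP => B _; apply: rW; exact: leey.
Qed.

End maxmin_duality.

(** * Linear programming *)

Section linear_programs.
Context (R : realType).

Lemma dotvv_le0 n (z : 'cV[R]_n) : dotv z z <= 0 -> z = 0.
Proof.
rewrite dotvE => z0; apply/matrixP => i j; rewrite (ord1 j) mxE; apply/eqP.
have h k : true -> 0 <= z k 0 * z k 0 by rewrite -expr2 sqr_ge0.
have : \sum_k z k 0 * z k 0 == 0 by rewrite eq_le z0 sumr_ge0.
by rewrite psumr_eq0// => /allP/(_ i); rewrite mem_index_enum mulf_eq0 orbb; apply.
Qed.

(** Both minimax arguments below end with a linear form that is bounded above on
    the half-line spanned by its own gradient. *)
Lemma dotv_half_line n (z : 'cV[R]_n) c :
  (forall t, 0 <= t -> t * dotv z z <= c) -> z = 0.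
Proof.
move=> h; apply: dotvv_le0; rewrite leNgt; apply/negP => z0.
have := h ((`|c| + 1) / dotv z z); rewrite divfK ?gt_eqF//.
rewrite divr_ge0 ?addr_ge0 ?(ltW z0)// => /(_ isT).
by have := ler_norm c; lra.
Qed.

Lemma dotv_diag_continuous n : continuous (fun x : 'cV[R]_n => dotv x x).
Proof.
rewrite (_ : (fun x => _) = fun x : 'cV[R]_n => \sum_i x i 0 * x i 0).
  apply: continuous_sum => i x.
  by apply: (@continuousM _ _ (fun x : 'cV[R]_n => x i 0)
    (fun x : 'cV[R]_n => x i 0)); exact: coord_continuous.
by apply/funext => x; rewrite dotvE.
Qed.

(** Among the maximisers, a point of largest Euclidean norm is a vertex, by
    strict convexity of the squared norm. *)
Lemma vertex_maximizer n (A : set 'cV[R]_n) c : compact A -> A !=set0 ->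
  exists2 x, vertices A x & forall y, A y -> dotv c y <= dotv c x.
Proof.
move=> cA A0.
have [x0 Ax0 x0max] : exists2 x, x \in A &
    forall y, y \in A -> dotv c y <= dotv c x.
  apply: compact_EVT_max => //; apply: continuous_subspaceT.
  exact: dotv_continuous.
have {}x0max y : A y -> dotv c y <= dotv c x0.
  by move=> Ay; apply: x0max; rewrite inE.
rewrite inE in Ax0.
pose F := A `&` [set y | dotv c x0 <= dotv c y].
have cF : compact F.
  apply: compact_closedI => //.
  apply: (@preimage_closed _ _ (dotv c) [set t | dotv c x0 <= t]).
    by move=> y _; exact: dotv_continuous.
  exact: closed_ge.
have [x xF xmax] : exists2 x, x \in F &
    forall y, y \in F -> dotv y y <= dotv x x.
  apply: compact_EVT_max => //; first by exists x0; split => /=.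
  by apply: continuous_subspaceT; exact: dotv_diag_continuous.
have {}xmax y : F y -> dotv y y <= dotv x x by move=> Fy; apply: xmax; rewrite inE.
move: xF; rewrite inE => -[Ax /= xc].
exists x => [|y Ay]; last exact: le_trans (x0max y Ay) xc.
split=> // a b t Aa Ab /andP[t0 t1] xE.
have xcE : dotv c x = t * dotv c a + (1 - t) * dotv c b.
  by rewrite {1}xE dotvDr !dotvZr.
have ac := x0max a Aa; have bc := x0max b Ab.
have Fa : F a by split=> //=; nra.
have Fb : F b by split=> //=; nra.
have ax := xmax a Fa; have bx := xmax b Fb.
have xx : dotv x x = t * dotv a a + (1 - t) * dotv b b
    - t * (1 - t) * dotv (a - b) (a - b).
  rewrite {1 2}xE !(dotvDr, dotvDl, dotvZr, dotvZl, dotvNl, dotvNr).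
  by rewrite (dotvC b a); ring.
have tt : 0 < t * (1 - t) by rewrite mulr_gt0// subr_gt0.
have /dotvv_le0/eqP : dotv (a - b) (a - b) <= 0.
  rewrite -(pmulr_rle0 _ tt).
  have := ler_wpM2l (ltW t0) ax.
  have := ler_wpM2l (ltW (_ : 0 < 1 - t)) bx; rewrite subr_gt0 => /(_ t1).
  by lra.
rewrite subr_eq0 => /eqP ab; rewrite xE ab -scalerDl addrCA subrr addr0 scale1r.
by [].
Qed.

Definition capped l M : set 'cV[R]_l :=
  [set theta | lev 0 theta /\ dotv (const_mx 1) theta <= M].

Lemma dotv1 l (x : 'cV[R]_l) : dotv (const_mx 1) x = \sum_i x i 0.
Proof. by rewrite dotvE; apply: eq_bigr => i _; rewrite mxE mul1r. Qed.

Lemma capped_compact l M : compact (@capped l M).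
Proof.
apply: (@cV_bounded_closed_compact _ _ _ M) => [x [x0 xM]|].
  have M0 : 0 <= M.
    by rewrite (le_trans _ xM)// dotv1 sumr_ge0// => i _; have := x0 i; rewrite mxE.
  rewrite /Num.Def.normr/= mx_normrE bigmax_le//= => -[i j] _ /=.
  rewrite (ord1 j) ger0_norm; last by have := x0 i; rewrite mxE.
  rewrite (le_trans _ xM)// dotv1 (bigD1 i)//= lerDl sumr_ge0// => k _.
  by have := x0 k; rewrite mxE.
rewrite (_ : @capped l M = \bigcap_i [set x : 'cV[R]_l | 0 <= x i 0] `&`
    [set x | dotv (const_mx 1) x <= M]); last first.
  apply/seteqP; split=> x [x0 xM]; split=> // i.
    by move=> _; have := x0 i; rewrite mxE.
  by rewrite mxE; exact: x0.
apply: closedI.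
  apply: closed_bigI => i _.
  apply: (@preimage_closed _ _ (fun x : 'cV[R]_l => x i 0) [set t | 0 <= t]).
    by move=> x _; exact: coord_continuous.
  exact: closed_ge.
apply: (@preimage_closed _ _ (dotv (const_mx 1)) [set t | t <= M]).
  by move=> x _; exact: dotv_continuous.
exact: closed_le.
Qed.

Lemma capped_mix l M (x y : 'cV[R]_l) t : capped M x -> capped M y ->
  0 <= t <= 1 -> capped M ((1 - t) *: x + t *: y).
Proof.
move=> [x0 xM] [y0 yM] /andP[t0 t1]; split.
  move=> i; have := x0 i; have := y0 i; rewrite !mxE => ? ?.
  by rewrite addr_ge0// mulr_ge0// subr_ge0.
by rewrite dotvDr !dotvZr; nra.
Qed.

Lemma capped_delta l M (i : 'I_l) : 0 <= M -> capped M (M *: delta_mx i 0).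
Proof.
move=> M0; split=> [j|]; first by rewrite !mxE mulr_ge0// ler0n.
by rewrite dotvZr dotvC dotv_delta mxE mulr1.
Qed.

Section dual.
Context (n l : nat) (q : 'cV[R]_n) (W : 'M[R]_(l, n)).
Hypothesis dual_ex : dual_feasible q W !=set0.
Hypothesis dual_compact : compact (dual_feasible q W).

(** Otherwise the minimax theorem over the simplex yields a recession direction
    of the dual feasible set, which compactness excludes. *)
Lemma slater_point : exists y0 : 'cV[R]_n, forall i, 1 <= (W *m y0) i 0.
Proof.
apply: contrapT => nex.
have hi (y : 'cV[R]_n) : exists i, (W *m y) i 0 < 1.
  apply: contrapT => ni; apply: nex; exists y => i; rewrite leNgt; apply/negP.
  by move=> yi; apply: ni; exists i.
pose D := capped 1 `&` [set x : 'cV[R]_l | dotv (const_mx 1) x = 1].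
have Ddelta i : D (delta_mx i 0).
  split; last by rewrite /= dotvC dotv_delta mxE.
  by rewrite -[delta_mx _ _]scale1r; exact: capped_delta.
have [th [[th0 _] /= th1] hth] : exists2 th, D th &
    forall y, [set: 'cV[R]_n] y -> -1 <= - dotv th (W *m y).
  apply: (@minimax R _ _ _
    (fun (th : 'cV[R]_l) (y : 'cV[R]_n) => - dotv th (W *m y))).
  - move=> y _ th; apply: (@continuousN _ _ _ (fun th => dotv th (W *m y))).
    rewrite (_ : (fun _ => _) = dotv (W *m y)); first exact: dotv_continuous.
    by apply/funext => x; rewrite dotvC.
  - apply: compact_closedI; first exact: capped_compact.
    apply: (@preimage_closed _ _ (dotv (const_mx 1)) [set 1]); last exact: closed_eq.
    by move=> x _; exact: dotv_continuous.
  - by have [i _] := hi 0; exists (delta_mx i 0).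
  - move=> u0 u1 t [c0 /= s0] [c1 /= s1] t01; exists ((1 - t) *: u0 + t *: u1).
      split; first exact: capped_mix.
      by rewrite /= dotvDr !dotvZr s0 s1; lra.
    by move=> y _; rewrite dotvDl !dotvZl; lra.
  - move=> y0 y1 t _ _ _; exists ((1 - t) *: y0 + t *: y1) => // u _.
    by rewrite mulmxDr -!scalemxAr dotvDr !dotvZr; lra.
  - move=> y _; have [i yi] := hi y; exists (delta_mx i 0) => //.
    by rewrite dotv_delta lerN2 ltW.
have Wth : W^T *m th = 0.
  apply: (@dotv_half_line _ _ 1) => t t0.
  have := hth (t *: (W^T *m th)) I.
  by rewrite -scalemxAr dotvZr -(dotv_trmx W th); lra.
have [th' Tth'] := dual_ex.
have [x _ xmax] : exists2 x, x \in dual_feasible q W &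
    forall y, y \in dual_feasible q W -> dotv (const_mx 1) y <= dotv (const_mx 1) x.
  apply: compact_EVT_max => //; apply: continuous_subspaceT.
  exact: dotv_continuous.
pose c := dotv (const_mx 1) x - dotv (const_mx 1) th'.
have c0 : 0 <= c by rewrite subr_ge0 xmax// inE.
have : dotv (const_mx 1) (th' + (c + 1) *: th) <= dotv (const_mx 1) x.
  apply: xmax; rewrite inE; case: Tth' => t0 tq; split.
    move=> i; have := t0 i; have := th0 i; rewrite !mxE => ? ?.
    by rewrite addr_ge0// mulr_ge0// addr_ge0.
  by rewrite mulmxDr -scalemxAr Wth scaler0 addr0.
by rewrite dotvDr dotvZr th1 /c; lra.
Qed.

(** Linear programming duality under a Slater point: capping the total
    multiplier by the cost of that point is an exact penalty, which makes the
    dual side compact and the minimax theorem applicable. *)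
Lemma lp_strong_duality b r :
  (forall y : 'cV[R]_n, lev b (W *m y) -> r <= dotv q y) ->
  exists2 th, dual_feasible q W th & r <= dotv th b.
Proof.
move=> hr; have [y0 y01] := slater_point.
pose M := `|dotv q y0|; have M0 : 0 <= M by [exact: normr_ge0].
have [th [th0 _] hth] : exists2 th, capped M th &
    forall y, [set: 'cV[R]_n] y -> r <= dotv q y + dotv th (b - W *m y).
  apply: (@minimax R _ _ _
    (fun (th : 'cV[R]_l) (y : 'cV[R]_n) => dotv q y + dotv th (b - W *m y))).
  - move=> y _ th.
    apply: (@continuousD _ _ _ (fun=> _) (fun th => dotv th (b - W *m y))).
      exact: cst_continuous.
    rewrite (_ : (fun _ => _) = dotv (b - W *m y)); first exact: dotv_continuous.
    by apply/funext => x; rewrite dotvC.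
  - exact: capped_compact.
  - by exists 0; split=> //; rewrite dotv0.
  - move=> u0 u1 t c0 c1 t01; exists ((1 - t) *: u0 + t *: u1).
      exact: capped_mix.
    by move=> y _; rewrite dotvDl !dotvZl; lra.
  - move=> x0 x1 t _ _ _; exists ((1 - t) *: x0 + t *: x1) => // u _.
    by rewrite mulmxDr -!scalemxAr !dotvBr !dotvDr !dotvZr; lra.
  - move=> y _; have [fy|] := pselect (lev b (W *m y)).
      exists 0; first by split=> //; rewrite dotv0.
      by rewrite dot0v addr0 hr.
    move=> /existsNP[i1 /negP]; rewrite -ltNge => yi1.
    (* Put the whole cap on the most violated constraint, and repair the
       violation by moving along the Slater point. *)
    pose i := [arg max_(i > i1) (b - W *m y) i 0]%O.
    have iP j : (b - W *m y) j 0 <= (b - W *m y) i 0.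
      by rewrite /i; case: arg_maxP => // j' _ /(_ j isT).
    set nu := (b - W *m y) i 0 in iP.
    have nu0 : 0 <= nu.
      by rewrite (le_trans _ (iP i1))// mxE [X in _ + X]mxE subr_ge0 ltW.
    exists (M *: delta_mx i 0); first exact: capped_delta.
    rewrite dotvZl dotv_delta -/nu.
    have : r <= dotv q (y + nu *: y0).
      apply: hr => j; rewrite mulmxDr -scalemxAr mxE [X in _ + X]mxE.
      have := iP j; rewrite mxE [X in _ + X]mxE.
      by have := ler_wpM2l nu0 (y01 j); lra.
    rewrite dotvDr dotvZr.
    by have := ler_wpM2l nu0 (ler_norm (dotv q y0)); rewrite -/M; lra.
have Wth : W^T *m th - q = 0.
  apply: (@dotv_half_line _ _ (dotv th b - r)) => t t0.
  have := hth (t *: (W^T *m th - q)) I.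
  rewrite dotvBr -dotv_trmx !dotvZr dotvBl; lra.
exists th; first by split=> //; apply/eqP; rewrite -subr_eq0 Wth.
by have := hth 0 I; rewrite dotv0 add0r mulmx0 subr0.
Qed.

End dual.

Lemma compact_gradients_bounded m (nrm : 'cV[R]_m -> R) (n : nat)
    (M : 'M[R]_(m, n)) (Y : set 'cV[R]_n) : vector_norm nrm -> compact Y ->
  exists L, forall y, Y y -> forall x, dotv (M *m y) x <= L * nrm x.
Proof.
move=> hnrm cY; have [Y0|/set0P Y0] := eqVneq Y set0.
  by exists 0 => y; rewrite Y0.
have [c c0 cP] := mx_le_vnorm hnrm.
pose S (y : 'cV[R]_n) := \sum_i `|(M *m y) i 0|.
have [y0 _ y0max] : exists2 y, y \in Y & forall z, z \in Y -> S z <= S y.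
  apply: compact_EVT_max => //; apply: continuous_subspaceT.
  apply: continuous_sum => i y.
  apply: (@continuous_comp _ _ _ (fun y : 'cV[R]_n => (M *m y) i 0) Num.norm).
    rewrite (_ : (fun _ => _) = dotv (row i M)^T); first exact: dotv_continuous.
    by apply/funext => x; rewrite mulmx_row_dotv.
  exact: norm_continuous.
exists (S y0 * c) => y Yy x; rewrite (le_trans (dotv_le_mx _ _))// -mulrA.
apply: ler_pM => //; first by rewrite sumr_ge0.
by apply: y0max; rewrite inE.
Qed.

End linear_programs.

(** * The two classes of two-stage losses *)

Section corollary.
Context (R : realType) (m : nat) (nrm : 'cV[R]_m -> R) (hnrm : vector_norm nrm).
Context (p : nat) (C : 'M[R]_(p, m)) (d : 'cV[R]_p).
Context (N : nat) (hN : (0 < N)%N) (xihat : 'I_N -> 'cV[R]_m).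
Hypothesis hxihat : forall i, polyhedron C d (xihat i).
Context (eps : R) (heps : 0 <= eps).
Local Notation P0 := (empirical xihat hN).

Section objective_uncertainty.
Context (n l : nat) (Q : 'M[R]_(n, m)) (W : 'M[R]_(l, n)) (h : 'cV[R]_l).
Let Y := [set y : 'cV[R]_n | lev h (W *m y)].
Hypotheses (Y_ex : Y !=set0) (Y_compact : compact Y).

Let argmin xi : exists2 y, Y y &
  forall z, Y z -> dotv y (Q *m xi) <= dotv z (Q *m xi).
Proof.
have [y yY ymin] : exists2 y, y \in Y &
    forall z, z \in Y -> dotv (Q *m xi) y <= dotv (Q *m xi) z.
  apply: compact_EVT_min => //; apply: continuous_subspaceT.
  exact: dotv_continuous.
rewrite inE in yY; exists y => // z Yz.
by rewrite dotvC (dotvC z) ymin// inE.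
Qed.

Let y_opt xi := s2val (cid2 (argmin xi)).
Let y_feas xi : Y (y_opt xi).
Proof. exact: s2valP (cid2 (argmin xi)). Qed.
Let y_min xi z : Y z -> dotv (y_opt xi) (Q *m xi) <= dotv z (Q *m xi).
Proof. exact: s2valP' (cid2 (argmin xi)) z. Qed.

Lemma worst_case_objective :
  worst_case_expectation (polyhedron C d) nrm P0 eps (loss_objective Q W h)
  = ereal_inf [set v | exists (lambda : R) (s : 'I_N -> R)
         (gamma : 'I_N -> 'cV[R]_p) (y : 'I_N -> 'cV[R]_n),
         [/\ forall i, dotv (y i) (Q *m xihat i)
                       + dotv (gamma i) (d - C *m xihat i) <= s i,
             forall i, lev h (W *m y i),
             forall i, (dual_norm nrm (Q^T *m y i - C^T *m gamma i)
                        <= lambda%:E)%E,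
             forall i, lev 0 (gamma i) &
             v = (lambda * eps + N%:R^-1 * \sum_(i < N) s i)%:E]].
Proof.
pose A (k : 'I_1) := [set a : 'cV[R]_m * R | exists2 y, Y y & a = (Q^T *m y, 0)].
have AE y xi : affval (Q^T *m y, 0) xi = dotv y (Q *m xi).
  by rewrite /affval/= addr0 dotv_trmx.
have -> : loss_objective Q W h =
    EFin \o (fun xi => dotv (y_opt xi) (Q *m xi)).
  apply/funext => xi; apply/eqP; rewrite eq_le; apply/andP; split.
    by apply: ereal_inf_lbound; exists (y_opt xi) => //; exact: y_feas.
  by apply: le_ereal_inf_tmp => _ [y Yy <-]; rewrite lee_fin y_min.
rewrite (@maxmin_duality _ _ _ hnrm _ C d _ hN xihat hxihat eps heps 1 A).
- congr ereal_inf; apply/seteqP; split=> v.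
    move=> [lambda [s [g [a [[Aa as_ al g0] ->]]]]].
    pose y i := s2val (cid2 (Aa (i, ord0))).
    have yE i : a (i, ord0) = (Q^T *m y i, 0) := s2valP' (cid2 (Aa (i, ord0))).
    exists lambda, s, (fun i => g (i, ord0)), y; split=> // i.
    + by have := as_ (i, ord0); rewrite yE AE.
    + exact: s2valP (cid2 (Aa (i, ord0))).
    + by have := al (i, ord0); rewrite yE.
  move=> [lambda [s [g [y [ys yY yl g0 ->]]]]].
  exists lambda, s, (fun j => g j.1), (fun j => (Q^T *m y j.1, 0)).
  split=> //; split=> j //=; first by exists (y j.1) => //; exact: yY.
  by rewrite AE.
- move=> k _ _ t [y Yy ->] [z Yz ->] /andP[t0 t1].
  exists ((1 - t) *: y + t *: z).
    move=> i; rewrite mulmxDr -!scalemxAr mxE [X in X + _]mxE [X in _ + X]mxE.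
    by have := Yy i; have := Yz i; nra.
  by rewrite mulmxDr -!scalemxAr /= !mulr0 addr0.
- have [L LP] := compact_gradients_bounded Q^T hnrm Y_compact.
  by exists L => k _ [y Yy ->]; exact: LP.
- move=> k xi; exists (Q^T *m y_opt xi, 0); split; last by rewrite AE.
    by exists (y_opt xi) => //; exact: y_feas.
  by move=> _ [y Yy ->]; rewrite !AE y_min.
- by move=> xi; exists ord0 => _ [y Yy ->]; rewrite AE y_min.
Qed.

End objective_uncertainty.

Section rhs_uncertainty.
Context (n l : nat) (q : 'cV[R]_n) (W : 'M[R]_(l, n)) (H : 'M[R]_(l, m))
  (h : 'cV[R]_l) (K : nat) (v : 'I_K -> 'cV[R]_l).
Hypotheses (dual_ex : dual_feasible q W !=set0)
  (dual_compact : compact (dual_feasible q W))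
  (v_vertices : range v = vertices (dual_feasible q W)).

Let piece k := (H^T *m v k, dotv (v k) h).

Let pieceE k xi : affval (piece k) xi = dotv (v k) (H *m xi + h).
Proof. by rewrite /affval dotvDr dotv_trmx. Qed.

Let best_vertex b : exists k, forall th, dual_feasible q W th ->
  dotv th b <= dotv (v k) b.
Proof.
have [x xV xmax] := vertex_maximizer b dual_compact dual_ex.
have : range v x by rewrite v_vertices.
move=> [k _ vk]; exists k => th Tth.
by rewrite vk dotvC (dotvC x) xmax.
Qed.

Let kopt xi := sval (cid (best_vertex (H *m xi + h))).
Let kopt_max xi th : dual_feasible q W th ->
  dotv th (H *m xi + h) <= dotv (v (kopt xi)) (H *m xi + h).
Proof. exact: svalP (cid (best_vertex (H *m xi + h))) th. Qed.

Let v_feas k : dual_feasible q W (v k).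
Proof.
have : vertices (dual_feasible q W) (v k) by rewrite -v_vertices; exists k.
by case.
Qed.

(** Linear programming duality, with the dual maximum taken at a vertex. It
    covers the feasibility of the primal problem as well: an infinite value
    would contradict the bound by a finite dual maximum. *)
Lemma loss_rhs_vertex :
  loss_rhs q W H h = EFin \o (fun xi => dotv (v (kopt xi)) (H *m xi + h)).
Proof.
apply/funext => xi; apply/eqP; rewrite eq_le; apply/andP; split; last first.
  apply: le_ereal_inf_tmp => _ [y /= yb <-]; rewrite lee_fin.
  have [v0 vq] := v_feas (kopt xi).
  rewrite -vq dotv_trmx -subr_ge0 -dotvBr dotv_ge0//.
  exact: (lev_subr _ _).1 yb.
have rle r : (r%:E <= loss_rhs q W H h xi)%E ->
    r <= dotv (v (kopt xi)) (H *m xi + h).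
  move=> rI; have [|th Tth rth] := lp_strong_duality dual_ex dual_compact
      (b := H *m xi + h) (r := r).
    move=> y yb; rewrite -lee_fin (le_trans rI)//.
    by apply: ereal_inf_lbound; exists y.
  exact: le_trans rth (kopt_max xi Tth).
case E : (loss_rhs q W H h xi) rle => [r||] rle; last exact: leNye.
  by rewrite lee_fin rle.
by exfalso; have := rle (dotv (v (kopt xi)) (H *m xi + h) + 1) (leey _); lra.
Qed.

Lemma worst_case_rhs :
  worst_case_expectation (polyhedron C d) nrm P0 eps (loss_rhs q W H h)
  = ereal_inf [set u | exists (lambda : R) (s : 'I_N -> R)
         (gamma : 'I_N -> 'I_K -> 'cV[R]_p),
         [/\ forall i k, dotv (v k) h + dotv (H^T *m v k) (xihat i)
                         + dotv (gamma i k) (d - C *m xihat i) <= s i,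
             forall i k, (dual_norm nrm (C^T *m gamma i k - H^T *m v k)
                          <= lambda%:E)%E,
             forall i k, lev 0 (gamma i k) &
             u = (lambda * eps + N%:R^-1 * \sum_(i < N) s i)%:E]].
Proof.
have dnN z lambda : (dual_norm nrm z <= lambda%:E)%E ->
    (dual_norm nrm (- z) <= lambda%:E)%E.
  move=> /(dual_norm_leP hnrm)[l0 zl]; apply/(dual_norm_leP hnrm); split=> // x.
  by rewrite dotvNl -dotvNr -(vnormN hnrm) zl.
rewrite loss_rhs_vertex.
rewrite (@maxmin_duality _ _ _ hnrm _ C d _ hN xihat hxihat eps heps K
  (fun k => [set piece k])).
- congr ereal_inf; apply/seteqP; split=> u.
    move=> [lambda [s [g [a [[Aa as_ al g0] ->]]]]].
    exists lambda, s, (fun i k => g (i, k)); split=> // i k.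
    + by have := as_ (i, k); rewrite (Aa (i, k)) /affval/= [dotv (v k) h + _]addrC.
    + by rewrite -opprB; apply: dnN; have := al (i, k); rewrite (Aa (i, k)).
  move=> [lambda [s [g [gs gl g0 ->]]]].
  exists lambda, s, (fun j => g j.1 j.2), (fun j => piece j.2).
  split=> //; split=> j //=.
    by rewrite /affval/= [X in X + _]addrC.
  by rewrite -opprB; apply: dnN.
- by move=> k _ _ t -> -> _; rewrite -scalerDl -mulrDl subrK scale1r mul1r.
- have [L LP] := compact_gradients_bounded H^T hnrm dual_compact.
  by exists L => k _ -> x; exact: LP.
- move=> k xi; exists (piece k); split=> // [b -> //|].
  by rewrite pieceE kopt_max.
- by move=> xi; exists (kopt xi) => _ ->; rewrite pieceE.
Qed.

End rhs_uncertainty.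

End corollary.

Theorem corollary5p4 (R : realType) (m : nat)
    (nrm : 'cV[R]_m -> R) (hnrm : vector_norm nrm)
    (p : nat) (C : 'M[R]_(p, m)) (d : 'cV[R]_p)
    (N : nat) (hN : (0 < N)%N) (xihat : 'I_N -> 'cV[R]_m)
    (hxihat : forall i, polyhedron C d (xihat i))
    (eps : R) (heps : 0 <= eps) :
  (forall (n l : nat) (Q : 'M[R]_(n, m)) (W : 'M[R]_(l, n)) (h : 'cV[R]_l),
     [set y : 'cV[R]_n | lev h (W *m y)] !=set0 ->
     compact [set y : 'cV[R]_n | lev h (W *m y)] ->
     worst_case_expectation (polyhedron C d) nrm (empirical xihat hN) eps
       (loss_objective Q W h)
     = ereal_inf [set v | exists (lambda : R) (s : 'I_N -> R)
         (gamma : 'I_N -> 'cV[R]_p) (y : 'I_N -> 'cV[R]_n),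
         [/\ forall i, dotv (y i) (Q *m xihat i)
                       + dotv (gamma i) (d - C *m xihat i) <= s i,
             forall i, lev h (W *m y i),
             forall i, (dual_norm nrm (Q^T *m y i - C^T *m gamma i)
                        <= lambda%:E)%E,
             forall i, lev 0 (gamma i) &
             v = (lambda * eps + N%:R^-1 * \sum_(i < N) s i)%:E]])
  /\
  (forall (n l : nat) (q : 'cV[R]_n) (W : 'M[R]_(l, n)) (H : 'M[R]_(l, m))
     (h : 'cV[R]_l) (K : nat) (v : 'I_K -> 'cV[R]_l),
     dual_feasible q W !=set0 ->
     compact (dual_feasible q W) ->
     range v = vertices (dual_feasible q W) ->
     worst_case_expectation (polyhedron C d) nrm (empirical xihat hN) eps
       (loss_rhs q W H h)
     = ereal_inf [set u | exists (lambda : R) (s : 'I_N -> R)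
         (gamma : 'I_N -> 'I_K -> 'cV[R]_p),
         [/\ forall i k, dotv (v k) h + dotv (H^T *m v k) (xihat i)
                         + dotv (gamma i k) (d - C *m xihat i) <= s i,
             forall i k, (dual_norm nrm (C^T *m gamma i k - H^T *m v k)
                          <= lambda%:E)%E,
             forall i k, lev 0 (gamma i k) &
             u = (lambda * eps + N%:R^-1 * \sum_(i < N) s i)%:E]]).
Proof.
split=> [n l Q W h Y_ex Y_compact|n l q W H h K v dual_ex dual_compact v_vert].
  exact: worst_case_objective.
exact: worst_case_rhs.
Qed.
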